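(* Let $\{Z_n\}_{n\ge 1}$ be a sequence of i.i.d. standard Gaussian random variables $N(0,1)$, and let $\{a_n\}_{n\ge1}$, $\{b_n\}_{n\ge1}$ be two non-increasing sequences of positive real numbers such that $\sum_{n=1}^{\infty}a_n<\infty$, $\sum_{n=1}^{\infty}b_n<\infty$, and such that the infinite products $$\prod_{n=1}^{\infty}\left(2-\frac{a_n/\|a\|_2}{b_n/\|b\|_2}\right)\quad\text{and}\quad\prod_{n=1}^{\infty}\left(2-\frac{b_n/\|b\|_2}{a_n/\|a\|_2}\right)$$ converge. Then, as $r\rightarrow\infty$, $$\mathbb{P}\left\{\sum_{n=1}^{\infty}a_n|Z_n|\geq r\|a\|_2\right\}\sim\mathbb{P}\left\{\sum_{n=1}^{\infty}b_n|Z_n|\geq r\|b\|_2\right\}.$$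
   Context: For a real sequence $a=\{a_n\}$, $\|a\|_2=\left(\sum_{n=1}^{\infty}a_n^2\right)^{1/2}$. The notation $F(r)\sim G(r)$ as $r\to\infty$ means $F(r)/G(r)\to1$ as $r\to\infty$. Convergence of an infinite product is meant in the usual sense for infinite products (in particular, the partial products of the tail have a finite nonzero limit). *)

(* Defs.v *)
From HB Require Import structures.
From mathcomp Require Import all_boot all_order all_algebra finmap.
From mathcomp Require Import all_classical all_reals all_analysis.

Set Implicit Arguments.
Unset Strict Implicit.
Unset Printing Implicit Defensive.

Import Order.TTheory GRing.Theory Num.Theory.
Import numFieldNormedType.Exports.

Local Open Scope classical_set_scope.
Local Open Scope ring_scope.

(* Meaningful when the series of squares converges; sequences are indexed
   from 0 throughout. *)
Definition l2norm (R : realType) (a : R^nat) : R :=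
  Num.sqrt (limn (series (fun n => a n ^+ 2))).

(* The starting index N lets finitely many factors vanish. *)
Definition prod_converges (R : realType) (u : R^nat) : Prop :=
  exists N : nat, exists2 l : R, l != 0 &
    \prod_(N <= i < n) u i @[n --> \oo] --> l.

(* Mutual independence: the product rule over every finite subfamily. *)
Definition independent_RVs (d : measure_display) (T : measurableType d)
    (R : realType) (P : probability T R) (Z : nat -> {RV P >-> R}) : Prop :=
  forall (J : {fset nat}) (A : nat -> set R),
    (forall j, j \in J -> measurable (A j)) ->
    P (\bigcap_(j in [set` J]) (Z j @^-1` A j)) =
    (\prod_(j <- J) P (Z j @^-1` A j))%E.

Definition iid_standard_normal (d : measure_display) (T : measurableType d)
    (R : realType) (P : probability T R) (Z : nat -> {RV P >-> R}) : Prop :=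
  independent_RVs Z /\
  forall (n : nat) (A : set R), measurable A ->
    distribution P (Z n) A = normal_prob 0 1 A.

(* The random series has nonnegative terms, so it is taken in \bar R, where it
   exists at every sample point. *)
Definition weighted_abs_sum (d : measure_display) (T : measurableType d)
    (R : realType) (P : probability T R) (Z : nat -> {RV P >-> R})
    (a : R^nat) (t : T) : \bar R :=
  (\sum_(0 <= n <oo) (a n * `|Z n t|)%:E)%E.

Definition tail_prob (d : measure_display) (T : measurableType d)
    (R : realType) (P : probability T R) (Z : nat -> {RV P >-> R})
    (a : R^nat) (r : R) : R :=
  fine (P [set t | ((r * l2norm a)%:E <= weighted_abs_sum Z a t)%E]).

Definition asymp_equiv (R : realType) (F G : R -> R) : Prop :=
  F r / G r @[r --> +oo] --> (1 : R).

(* Main.v *)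
Require Import Defs.
From HB Require Import structures.
From mathcomp Require Import all_boot all_order all_algebra finmap.
From mathcomp Require Import all_classical all_reals all_analysis.
From mathcomp Require Import measurable_realfun ring lra.

(** Normalize both sequences to have unit Euclidean norm, write [phi] and [Phi] for
    the standard normal density and distribution function, and let [h_a (s)] be the
    product of the [2 * Phi (s * a_n)] over [n >= 1]. Multiplied by [2 * Phi (s * a_0)]
    and by [exp (s^2 / 2)] it is the Laplace transform of [sum_n a_n |Z_n|] at [s]. The
    theorem holds because the sum has a density which at [s] is equivalent to
    [2 * phi (s) * h_a (s)], and because the hypothesis on the products makes
    [h_a / h_b] tend to 1.

    The density. Integrating [Z_0] first ([tail_density]) shows that the sum has a
    density, the mean of a Gaussian function of [S = sum_(n >= 1) a_n |Z_n|]. Tilting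
    the law of [S] by [exp (s x)] turns that function into a fixed Gaussian bump
    around the mean of the tilted sum ([density_fun_tilt]); the choice of [s] itself as
    the tilt makes the two centres agree. Under the tilt each [|Z_n|] becomes a
    normal variable of mean [s * a_n] conditioned to be nonnegative, and the total
    mass becomes [h_a (s)]. Forgetting the conditioning one variable at a time, in the
    manner of Lindeberg, replaces the sum by a normal variable
    ([tilted_mean_gauss_bump]). Bumps are stable under Gaussian convolution
    ([normal_mean_gauss_bump]), so they remain the only test functions.
    The step for [a_n] costs at most a multiple of the smaller of [a_n] and [1 / s]
    ([half_line_replacement], [step_error_bounded]), and since [sum_n a_n] is finite
    the total cost tends to 0 as [s] grows ([error_sum_vanishes]). All this is done
    for partial sums, with estimates that survive the passage to the limit: an upper
    bound uniform in [s] ([density_le_eventually]) and a lower bound at each [s]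
    ([density_ge_eventually]), combined by Fatou's lemma in [strict_tail_compare].

    The products. Concavity of [Phi] on the nonnegative reals gives, with [x = s * b_n]
    and [rho = a_n / b_n], that [Phi (rho * x) / Phi (x)] is at most
    [1 + w (x) * (rho - 1)], where [w (x) = x * phi (x) / Phi (x)], hence, for [rho < 2], at
    most [exp (- w (x) * ln (2 - rho))] ([halfmass_ratio]). The series of the
    [ln (2 - a_n / b_n)] converges by hypothesis, perhaps only conditionally. The
    function [w] is bounded and of bounded variation, so along the monotone sequence
    [s * b_n] its variation is bounded uniformly in [s], and summation by parts makes
    the tail of the weighted series uniformly small ([halfmass_prod_compare]). The
    remaining factors, finite in number, tend to 1 as [s] grows.

    This bounds the upper limit of the ratio of the two tails by 1 ([tail_compare]);
    exchanging the sequences gives the lower bound. *)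

Set Implicit Arguments.
Unset Strict Implicit.
Unset Printing Implicit Defensive.

Import Order.TTheory GRing.Theory Num.Theory.
Import numFieldNormedType.Exports.

Local Open Scope classical_set_scope.
Local Open Scope ring_scope.

(** * Image measures and affine changes of variable *)

Section ImageMeasure.
Context d d' (T1 : measurableType d) (T2 : measurableType d') (R : realType).

(** [pushforward] is a measure only in the presence of a proof of measurability;
    making that proof an argument keeps it from being left to unification. *)
Definition image_measure (m : {measure set T1 -> \bar R}) (f : T1 -> T2)
    (mf : measurable_fun [set: T1] f) : {measure set T2 -> \bar R} :=
  measure_function_pushforward__canonical__measure_function_Measure m mf.

End ImageMeasure.

Section ChangeOfVariables.
Context {R : realType}.
Local Notation mu := (@lebesgue_measure R).

Lemma integral_affine (f : R -> \bar R) (c b : R) : 0 < c ->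
  measurable_fun [set: R] f -> (forall x, 0 <= f x)%E ->
  (\int[mu]_x f x = c%:E * \int[mu]_x f (c * x + b)%R)%E.
Proof.
move=> c0 mf f0.
pose F : measurableTypeR R -> measurableTypeR R := fun x => c * x + b.
have mF : measurable_fun [set: measurableTypeR R] F.
  by apply: measurable_funD => //; exact: measurable_funM.
pose c' : {nonneg R} := NngNum (ltW c0).
have -> : (c%:E * \int[mu]_x f (c * x + b)%R =
    \int[mscale c' (image_measure mu mF)]_x f x)%E.
  rewrite ge0_integral_mscale//=; congr (_ * _)%E.
  by rewrite ge0_integral_pushforward.
(* Two measures that agree on bounded intervals are equal. *)
apply: eq_measure_integral => A mA _.
apply: lebesgue_measure_unique => // _ [[a d]] _ <- /=.
rewrite /mscale/= /pushforward.
have -> : F @^-1` `]a, d] = `](a - b) / c, (d - b) / c]%classic.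
  apply/seteqP; split => x /=; rewrite !in_itv /= /F.
    by rewrite ltr_pdivrMr// ler_pdivlMr// ltrBlDr lerBrDr mulrC.
  by rewrite ltr_pdivrMr// ler_pdivlMr// ltrBlDr lerBrDr mulrC.
rewrite !lebesgue_measure_itv/= !lte_fin ltr_pM2r ?invr_gt0// ltrD2r.
case: ifPn => _; last by rewrite mule0.
rewrite -!EFinD -EFinM; congr (_%:E).
by field; rewrite gt_eqF.
Qed.

Lemma integral_shift (f : R -> \bar R) (b : R) :
  measurable_fun [set: R] f -> (forall x, 0 <= f x)%E ->
  (\int[mu]_x f x = \int[mu]_x f (x + b)%R)%E.
Proof.
move=> mf f0; rewrite (integral_affine b ltr01 mf f0) mul1e.
by under eq_integral do rewrite mul1r.
Qed.

Lemma integral_abs (k : R -> \bar R) :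
  measurable_fun [set: R] k -> (forall x, 0 <= k x)%E ->
  (\int[mu]_x k `|x|%R = 2%:E * \int[mu]_(x in `[0%R, +oo[) k x)%E.
Proof.
move=> mk k0.
have mka : measurable_fun setT (fun x : R => k `|x|).
  by apply: measurableT_comp.
rewrite -{1}(setvU `[0%R, +oo[%classic) setCitvr ge0_integral_setU//=; first last.
- rewrite disj_set2E; apply/eqP; rewrite -subset0 => x/=.
  by rewrite !in_itv/= andbT ltNge => -[/negP].
- exact: measurable_funS mka.
rewrite (_ : (\int[mu]_(x in `[0%R, +oo[) k `|x|%R =
  \int[mu]_(x in `[0%R, +oo[) k x)%E); last first.
  apply: eq_integral => x; rewrite inE/= in_itv/= andbT => x0.
  by rewrite ger0_norm.
rewrite (_ : (\int[mu]_(x in `]-oo, 0%R[) k `|x|%R =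
  \int[mu]_(x in `[0%R, +oo[) k x)%E); last first.
  rewrite integral_itv_bndo_bndc; last exact: measurable_funS mka.
  rewrite ge0_integration_by_substitution0//.
  apply: eq_integral => x; rewrite inE/= in_itv/= => x0.
  by rewrite ler0_norm.
by rewrite -mule2n mule_natl.
Qed.

End ChangeOfVariables.

(** * Means under normal laws of unit variance *)

Section GaussianMean.
Context {R : realType}.
Local Notation mu := (@lebesgue_measure R).
Implicit Types (x y z m : R) (k g : R -> R).

Definition std_pdf x : R := normal_pdf 0 1 x.

Lemma std_pdfE x : std_pdf x = normal_peak 1 * expR (- (x ^+ 2 / 2)).
Proof.
rewrite /std_pdf normal_pdfE ?oner_eq0//; congr (_ * _).
by rewrite /normal_fun subr0 expr1n mulNr.
Qed.

Lemma std_pdf_gt0 x : 0 < std_pdf x.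
Proof. by rewrite std_pdfE mulr_gt0 ?expR_gt0// normal_peak_gt0 ?oner_eq0. Qed.

Lemma std_pdf_ge0 x : 0 <= std_pdf x.
Proof. exact: ltW (std_pdf_gt0 x). Qed.

Lemma std_pdf_norm x : std_pdf `|x| = std_pdf x.
Proof. by rewrite !std_pdfE real_normK ?num_real. Qed.

Lemma le_std_pdf x y : `|x| <= `|y| -> std_pdf y <= std_pdf x.
Proof.
move=> xy; rewrite !std_pdfE ler_wpM2l ?normal_peak_ge0// ler_expR lerN2.
by rewrite ler_pM2r ?invr_gt0// -(@real_normK _ x) ?num_real//
  -(@real_normK _ y) ?num_real// lerXn2r ?nnegrE.
Qed.

Lemma std_pdf_tilt m x : std_pdf (x - m) = std_pdf x * expR (m * x - m ^+ 2 / 2).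
Proof.
rewrite !std_pdfE -[RHS]mulrA -expRD; congr (_ * expR _).
by field.
Qed.

Lemma measurable_std_pdf : measurable_fun [set: R] std_pdf.
Proof. exact: measurable_normal_pdf. Qed.

Lemma measurable_std_pdfB m : measurable_fun [set: R] (fun z => std_pdf (z - m)).
Proof.
apply: (measurableT_comp measurable_std_pdf).
by apply: measurable_funB.
Qed.

(** The mean of [k] under the normal law centred at [m]. It is extended-real valued
    so that nonnegative integrands need no proof of integrability. *)
Definition normal_mean m k : \bar R := (\int[mu]_z (std_pdf (z - m) * k z)%:E)%E.

Lemma measurable_normal_mean m k : measurable_fun [set: R] k ->
  measurable_fun [set: R] (fun z => (std_pdf (z - m) * k z)%:E).
Proof.
move=> mk; apply/measurable_EFinP.
by apply: measurable_funM => //; exact: measurable_std_pdfB.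
Qed.

Lemma normal_mean_ge0 m k : (forall z, 0 <= k z) -> (0 <= normal_mean m k)%E.
Proof.
by move=> k0; apply: integral_ge0 => z _; rewrite lee_fin mulr_ge0 ?std_pdf_ge0.
Qed.

Lemma eq_normal_mean m k g : k =1 g -> normal_mean m k = normal_mean m g.
Proof. by move=> kg; apply: eq_integral => z _; rewrite kg. Qed.

Lemma normal_meanD m k g : measurable_fun [set: R] k -> measurable_fun [set: R] g ->
  (forall z, 0 <= k z) -> (forall z, 0 <= g z) ->
  normal_mean m (fun z => k z + g z) = (normal_mean m k + normal_mean m g)%E.
Proof.
move=> mk mg k0 g0; rewrite /normal_mean -ge0_integralD//=.
- by apply: eq_integral => z _; rewrite mulrDr EFinD.
- by move=> z _; rewrite lee_fin mulr_ge0 ?std_pdf_ge0.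
- exact: measurable_normal_mean.
- by move=> z _; rewrite lee_fin mulr_ge0 ?std_pdf_ge0.
- exact: measurable_normal_mean.
Qed.

Lemma normal_meanZ m k c : measurable_fun [set: R] k ->
  (forall z, 0 <= k z) -> 0 <= c ->
  normal_mean m (fun z => c * k z) = (c%:E * normal_mean m k)%E.
Proof.
move=> mk k0 c0; rewrite /normal_mean -ge0_integralZl//=.
- by apply: eq_integral => z _; rewrite mulrCA EFinM.
- exact: measurable_normal_mean.
- by move=> z _; rewrite lee_fin mulr_ge0 ?std_pdf_ge0.
Qed.

Lemma le_normal_mean m k g : measurable_fun [set: R] k -> measurable_fun [set: R] g ->
  (forall z, 0 <= k z) -> (forall z, k z <= g z) -> (normal_mean m k <= normal_mean m g)%E.
Proof.
move=> mk mg k0 kg; apply: ge0_le_integral => //=.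
- by move=> z _; rewrite lee_fin mulr_ge0 ?std_pdf_ge0.
- exact: measurable_normal_mean.
- exact: measurable_normal_mean.
- by move=> z _; rewrite lee_fin ler_wpM2l ?std_pdf_ge0.
Qed.

Lemma normal_mean_shift m k : measurable_fun [set: R] k -> (forall z, 0 <= k z) ->
  normal_mean m k = normal_mean 0 (fun z => k (z + m)).
Proof.
move=> mk k0; pose f z := (std_pdf (z - m) * k z)%:E.
have f0 z : (0 <= f z)%E by rewrite lee_fin mulr_ge0 ?std_pdf_ge0.
rewrite [LHS](integral_shift m (measurable_normal_mean m mk) f0).
by apply: eq_integral => z _; rewrite addrK subr0.
Qed.

Lemma normal_mean1 m : normal_mean m (fun=> 1) = 1%E.
Proof.
rewrite normal_mean_shift// /normal_mean -[RHS](@integral_normal_pdf R 0 1).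
by apply: eq_integral => z _; rewrite mulr1 subr0.
Qed.

Lemma normal_mean_cst m c : 0 <= c -> normal_mean m (fun=> c) = c%:E.
Proof.
move=> c0; rewrite (@eq_normal_mean _ _ (fun z => c * (fun=> 1) z)) => [|z]; last first.
  by rewrite mulr1.
by rewrite normal_meanZ ?normal_mean1 ?mule1// => z; exact: ler01.
Qed.

(** [normal_prob] integrates its density over sets; that the density also computes
    integrals of functions follows from the uniqueness of Radon-Nikodym
    derivatives up to negligible sets. *)
Lemma integral_normal_prob (f : R -> \bar R) :
  measurable_fun [set: R] f -> (forall x, 0 <= f x)%E ->
  (\int[normal_prob 0 1]_x f x = \int[mu]_x (f x * (std_pdf x)%:E))%E.
Proof.
move=> mf f0.
pose nu : probability _ R := @normal_prob R 0 1.
have dom : nu `<< mu := @normal_prob_dominates R 0 1.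
rewrite -(Radon_Nikodym_SigmaFinite.change_of_variables dom f0)//.
have fi := Radon_Nikodym_SigmaFinite.f_integrable dom.
have mfi := measurable_int _ fi.
have aeE : ae_eq mu setT (Radon_Nikodym_SigmaFinite.f nu mu) (EFin \o std_pdf).
  apply: integral_ae_eq => //.
  - by apply/measurable_EFinP; exact: measurable_std_pdf.
  - by move=> E _ mE; rewrite -Radon_Nikodym_SigmaFinite.f_integral.
apply: ge0_ae_eq_integral => //.
- exact: emeasurable_funM.
- by apply: emeasurable_funM => //; apply/measurable_EFinP; exact: measurable_std_pdf.
- by move=> x _; rewrite mule_ge0// Radon_Nikodym_SigmaFinite.f_ge0.
- by move=> x _; rewrite mule_ge0// lee_fin std_pdf_ge0.
- exact: ae_eqe_mul2l.
Qed.

Definition nonneg_ind z : R := (0 <= z)%R%:R.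

Lemma nonneg_indE z : nonneg_ind z = (0 <= z)%R%:R. Proof. by []. Qed.

Lemma measurable_nonneg_ind : measurable_fun [set: R] nonneg_ind.
Proof.
rewrite (_ : nonneg_ind = \1_(`[0, +oo[%classic : set R)).
  exact: measurable_indic.
by apply/funext => z; rewrite indicE mem_setE in_itv/= andbT.
Qed.

Lemma nonneg_ind_ge0 z : 0 <= nonneg_ind z. Proof. by rewrite nonneg_indE. Qed.

Lemma nonneg_ind_le1 z : nonneg_ind z <= 1.
Proof. by rewrite nonneg_indE; case: (0 <= z). Qed.

(** Tilting [|z|] by [m] turns the even density into that of the normal law centred
    at [m] on each half line, whence the factor 2 and the cut at the origin. *)
Lemma normal_mean_fold m k : measurable_fun [set: R] k -> (forall z, 0 <= k z) ->
  normal_mean 0 (fun z => expR (m * `|z| - m ^+ 2 / 2) * k `|z|) =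
  (2%:E * normal_mean m (fun z => nonneg_ind z * k z)%R)%E.
Proof.
move=> mk k0.
transitivity (\int[mu]_z (std_pdf (`|z| - m) * k `|z|)%:E)%E.
  apply: eq_integral => z _.
  by rewrite subr0 mulrA (std_pdf_tilt m `|z|) std_pdf_norm.
rewrite (@integral_abs _ (fun z => (std_pdf (z - m) * k z)%:E)).
- congr (_ * _)%E; rewrite integral_mkcond; apply: eq_integral => z _.
  rewrite patchE mem_setE in_itv/= andbT nonneg_indE.
  by case: (0 <= z); rewrite ?mul1r ?mul0r ?mulr0.
- exact: measurable_normal_mean.
- by move=> z; rewrite lee_fin mulr_ge0 ?std_pdf_ge0.
Qed.

End GaussianMean.

(** * The mass of the half line and the moments of the normal law *)

Section GaussianMass.
Context {R : realType}.
Local Notation mu := (@lebesgue_measure R).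
Implicit Types (x y z m : R) (k g : R -> R).

Lemma measurable_norm_sub m : measurable_fun [set: R] (fun z => `|z - m|).
Proof. by apply: measurableT_comp => //; exact: measurable_funB. Qed.

Lemma measurable_sqr_sub m : measurable_fun [set: R] (fun z => (z - m) ^+ 2).
Proof. by apply: measurable_funX; exact: measurable_funB. Qed.

(** As [x^2] is at most [4 exp (x^2 / 4)], the integrand is dominated by a multiple
    of the normal density of variance 2. *)
Lemma normal_mean_sqr_bounded : exists2 C : R, 0 < C &
  forall m, (normal_mean m (fun z => ((z - m) ^+ 2)%R) <= C%:E)%E.
Proof.
pose s : R := Num.sqrt 2.
have s0 : s != 0 by rewrite gt_eqF// sqrtr_gt0.
have s2 : s ^+ 2 = 2 by rewrite sqr_sqrtr.
pose C : R := 4 * (normal_peak 1 / normal_peak s).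
have C0 : 0 < C.
  by rewrite mulr_gt0// divr_gt0// normal_peak_gt0// oner_eq0.
exists C => // m.
rewrite normal_mean_shift; [|exact: measurable_sqr_sub|by move=> z; exact: sqr_ge0].
apply: (@le_trans _ _ (\int[mu]_z (C%:E * (normal_pdf 0 s z)%:E))%E).
  apply: ge0_le_integral => //=.
  - by move=> z _; rewrite lee_fin mulr_ge0 ?std_pdf_ge0 ?sqr_ge0.
  - apply: measurable_normal_mean; apply: measurable_funX.
    by apply: measurable_funB => //; exact: measurable_funD.
  - apply/measurable_EFinP; apply: measurable_funM => //.
    exact: measurable_normal_pdf.
  move=> z _; rewrite -EFinM lee_fin subr0 addrK normal_pdfE// std_pdfE.
  rewrite /normal_fun subr0 s2.
  have -> : C * (normal_peak s * expR (- z ^+ 2 / (2 *+ 2))) =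
     normal_peak 1 * (4 * expR (- z ^+ 2 / (2 *+ 2))).
    rewrite /C; field.
    by rewrite gt_eqF// normal_peak_gt0.
  rewrite -mulrA ler_wpM2l ?normal_peak_ge0//.
  have -> : - (z ^+ 2 / 2) = - z ^+ 2 / (2 *+ 2) - z ^+ 2 / 4
    by rewrite -mulr_natr; field.
  rewrite expRD mulrAC [leRHS]mulrC -mulrA ler_wpM2l ?expR_ge0//.
  rewrite expRN -ler_pdivlMr ?invr_gt0 ?expR_gt0// invrK.
  have := expR_ge1Dx (z ^+ 2 / 4).
  lra.
rewrite ge0_integralZl//=.
- by rewrite integral_normal_pdf mule1.
- by apply/measurable_EFinP; exact: measurable_normal_pdf.
- by move=> z _; rewrite lee_fin normal_pdf_ge0.
- by rewrite lee_fin ltW.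
Qed.

Lemma normal_mean_norm_bounded : exists2 C : R, 0 < C &
  forall m, (normal_mean m (fun z => `|z - m|%R) <= C%:E)%E.
Proof.
have [C C0 hC] := normal_mean_sqr_bounded.
exists (1 + C) => [|m]; first by rewrite addr_gt0.
apply: (@le_trans _ _ (normal_mean m (fun z => 1 + (z - m) ^+ 2)%R)).
  apply: le_normal_mean => //.
  - exact: measurable_norm_sub.
  - by apply: measurable_funD => //; exact: measurable_sqr_sub.
  - move=> z; rewrite -[leRHS]addr0 -(@real_normK _ (z - m)) ?num_real//.
    have := sqr_ge0 (`|z - m| - 1); have := normr_ge0 (z - m); nra.
rewrite normal_meanD//.
- by rewrite normal_mean1 EFinD leeD2l// hC.
- exact: measurable_sqr_sub.
- by move=> z; exact: sqr_ge0.
Qed.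

(** This is the standard normal distribution function at [m], written in the form in
    which tilted folded variables produce it. *)
Definition halfmass m : R := fine (normal_mean m nonneg_ind).

Lemma normal_mean_ind m : normal_mean m nonneg_ind = (halfmass m)%:E.
Proof.
rewrite /halfmass fineK// ge0_fin_numE.
  apply: le_lt_trans (ltry 1); rewrite -(normal_mean1 m); apply: le_normal_mean => //.
  - exact: measurable_nonneg_ind.
  - exact: nonneg_ind_le1.
by apply: normal_mean_ge0; exact: nonneg_ind_ge0.
Qed.

Lemma halfmass_ge0 m : 0 <= halfmass m.
Proof. by rewrite -lee_fin -normal_mean_ind normal_mean_ge0//; exact: nonneg_ind_ge0. Qed.

Lemma halfmassC m : normal_mean m (fun z => 1 - nonneg_ind z) = (1 - halfmass m)%:E.
Proof.
have mi := @measurable_nonneg_ind R.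
have h : (normal_mean m (fun z => (1 - nonneg_ind z)%R) + normal_mean m nonneg_ind = 1)%E.
  rewrite -normal_meanD//.
  - by rewrite -(normal_mean1 m); apply: eq_normal_mean => z; rewrite subrK.
  - exact: measurable_funB.
  - by move=> z; rewrite subr_ge0 nonneg_ind_le1.
by rewrite EFinB -h normal_mean_ind addeK.
Qed.

Lemma halfmass_le1 m : halfmass m <= 1.
Proof.
rewrite -subr_ge0 -lee_fin -halfmassC normal_mean_ge0// => z.
by rewrite subr_ge0 nonneg_ind_le1.
Qed.

(** Folding without tilting. *)
Lemma halfmass0 : halfmass 0 = 2^-1.
Proof.
have := @normal_mean_fold R 0 (fun=> 1) _ (fun=> ler01).
rewrite -[X in _ = (_ * X)%E](@eq_normal_mean _ _ nonneg_ind); last first.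
  by move=> z; rewrite mulr1.
rewrite normal_mean_ind (@eq_normal_mean _ _ _ (fun=> 1)); last first.
  by move=> z; rewrite mul0r expr0n/= mul0r subr0 expR0 mulr1.
rewrite normal_mean1 -EFinM => /(_ (measurable_cst _)) [] h.
by apply: (mulfI (_ : 2 != 0)) => //; rewrite -h mulfV.
Qed.

Lemma measurable_half_line y : measurable_fun [set: R] (fun u => (- y <= u)%R%:R : R).
Proof.
rewrite (_ : (fun u => _) = nonneg_ind \o (fun u => u + y)); last first.
  by apply/funext => u; rewrite /= nonneg_indE -lerBlDr sub0r.
apply: measurableT_comp; first exact: measurable_nonneg_ind.
exact: measurable_funD.
Qed.

Lemma halfmass_itv m :
  (halfmass m)%:E = (\int[mu]_u (std_pdf u * ((- m <= u)%R%:R))%:E)%E.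
Proof.
rewrite -normal_mean_ind normal_mean_shift.
- apply: eq_integral => u _; rewrite subr0 nonneg_indE.
  by rewrite -lerBlDr sub0r.
- exact: measurable_nonneg_ind.
- exact: nonneg_ind_ge0.
Qed.

Lemma integral_between x y : x <= y ->
  (\int[mu]_u (((- y <= u)%R%:R - (- x <= u)%R%:R) : R)%:E = (y - x)%:E)%E.
Proof.
move=> xy.
transitivity (\int[mu]_u (\1_(`[- y, - x[%classic : set R) u)%:E)%E.
  apply: eq_integral => u _; rewrite indicE mem_setE in_itv/= ltNge.
  have [yu|yu] := leP (- y) u; have [xu|xu] := leP (- x) u; congr (_%:E) => /=.
  - by rewrite subrr.
  - by rewrite subr0.
  - by have := lt_le_trans yu (le_trans _ xu); rewrite lerN2 xy ltxx => /(_ isT).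
  - by rewrite subrr.
rewrite integral_indic//= setIT lebesgue_measure_itv/= lte_fin ltrN2.
have := xy; rewrite le_eqVlt => /predU1P[->|->]; first by rewrite ltxx subrr.
by rewrite -EFinD opprK addrC.
Qed.

Lemma measurable_between x y (c : R) :
  measurable_fun [set: R]
    (fun u => (c * (((- y <= u)%R%:R - (- x <= u)%R%:R) : R))%:E).
Proof.
apply/measurable_EFinP; apply: measurable_funM => //.
by apply: measurable_funB; exact: measurable_half_line.
Qed.

Lemma between_ge0 x y (u : R) : x <= y ->
  0 <= ((- y <= u)%R%:R - (- x <= u)%R%:R : R).
Proof.
move=> xy; have [xu|_] := leP (- x) u; last by rewrite subr0.
by rewrite (le_trans _ xu) ?lerN2// subrr.
Qed.

Lemma measurable_half_std_pdf x :
  measurable_fun [set: R] (fun u => (std_pdf u * ((- x <= u)%R%:R))%:E).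
Proof.
apply/measurable_EFinP; apply: measurable_funM; first exact: measurable_std_pdf.
exact: measurable_half_line.
Qed.

(** The density decreases on the nonnegative reals, so the mass of the half line is
    concave there and lies below its tangents. The increment is the integral of
    the density between [- y] and [- x], which is compared with a constant. *)
Lemma halfmass_tangent x y : 0 <= x -> 0 <= y ->
  halfmass y <= halfmass x + std_pdf x * (y - x).
Proof.
move=> x0 y0; rewrite -lee_fin.
have g0 := @std_pdf_ge0 R x.
have [xy|/ltW yx] := leP x y.
  rewrite EFinD EFinM -integral_between// -ge0_integralZl//=; first last.
  - by move=> u _; rewrite lee_fin between_ge0.
  - by apply/measurable_EFinP; apply: measurable_funB; exact: measurable_half_line.
  rewrite !halfmass_itv -ge0_integralD//=; first last.
  - exact: measurable_between.
  - by move=> u _; rewrite lee_fin mulr_ge0// between_ge0.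
  - exact: measurable_half_std_pdf.
  - by move=> u _; rewrite lee_fin mulr_ge0 ?std_pdf_ge0.
  apply: ge0_le_integral => //=.
  - by move=> u _; rewrite lee_fin mulr_ge0 ?std_pdf_ge0.
  - exact: measurable_half_std_pdf.
  - apply: emeasurable_funD; first exact: measurable_half_std_pdf.
    exact: measurable_between.
  move=> u _; rewrite -EFinM -EFinD lee_fin.
  have [xu|xu] := leP (- x) u.
    by rewrite (le_trans _ xu) ?lerN2// subrr mulr0 addr0.
  rewrite mulr0 add0r subr0; have [yu|yu] := leP (- y) u; last by rewrite !mulr0.
  rewrite !mulr1; apply: le_std_pdf; rewrite ger0_norm// ler0_norm; last first.
    by rewrite (le_trans (ltW xu))// oppr_le0.
  by rewrite lerNr ltW.
suff : halfmass y + std_pdf x * (x - y) <= halfmass x.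
  by rewrite lee_fin -lerBrDr -mulrN opprB.
rewrite -lee_fin EFinD EFinM -integral_between// -ge0_integralZl//=; first last.
- by move=> u _; rewrite lee_fin between_ge0.
- by apply/measurable_EFinP; apply: measurable_funB; exact: measurable_half_line.
rewrite !halfmass_itv -ge0_integralD//=; first last.
- exact: measurable_between.
- by move=> u _; rewrite lee_fin mulr_ge0// between_ge0.
- exact: measurable_half_std_pdf.
- by move=> u _; rewrite lee_fin mulr_ge0 ?std_pdf_ge0.
apply: ge0_le_integral => //=.
- by move=> u _; rewrite -EFinM -EFinD lee_fin addr_ge0// mulr_ge0 ?std_pdf_ge0// between_ge0.
- apply: emeasurable_funD; first exact: measurable_half_std_pdf.
  exact: measurable_between.
- exact: measurable_half_std_pdf.
move=> u _; rewrite -EFinM -EFinD lee_fin.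
have [yu|yu] := leP (- y) u.
  by rewrite (le_trans _ yu) ?lerN2// subrr mulr0 addr0.
rewrite mulr0 add0r subr0; have [xu|xu] := leP (- x) u; last by rewrite !mulr0.
rewrite !mulr1; apply: le_std_pdf; rewrite [leRHS]ger0_norm// ler0_norm; last first.
  by rewrite (le_trans (ltW yu))// oppr_le0.
by rewrite lerNl.
Qed.

Lemma halfmass_mono x y : x <= y -> halfmass x <= halfmass y.
Proof.
move=> xy; rewrite -lee_fin !halfmass_itv.
apply: ge0_le_integral => //=.
- by move=> u _; rewrite lee_fin mulr_ge0 ?std_pdf_ge0.
- exact: measurable_half_std_pdf.
- exact: measurable_half_std_pdf.
- move=> u _; rewrite lee_fin ler_wpM2l ?std_pdf_ge0//.
  by rewrite -subr_ge0 between_ge0.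
Qed.

Lemma halfmass_ge_half m : 0 <= m -> 2^-1 <= halfmass m.
Proof. by move=> m0; rewrite -halfmass0 halfmass_mono. Qed.

Lemma halfmass_gt0 m : 0 <= m -> 0 < halfmass m.
Proof. by move=> /halfmass_ge_half; apply: lt_le_trans; rewrite invr_gt0. Qed.

(** Markov's inequality: at [z < 0] the distance to [m] is at least [m]. *)
Lemma halfmassC_bounded : exists2 C : R, 0 < C &
  forall m, 0 <= m -> m * (1 - halfmass m) <= C.
Proof.
have [C C0 hC] := normal_mean_norm_bounded; exists C => // m m0.
have mi := @measurable_nonneg_ind R.
rewrite -lee_fin EFinM -halfmassC -normal_meanZ//; last 2 first.
- exact: measurable_funB.
- by move=> z; rewrite subr_ge0 nonneg_ind_le1.
apply: le_trans (hC m); apply: le_normal_mean.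
- by apply: measurable_funM => //; exact: measurable_funB.
- exact: measurable_norm_sub.
- by move=> z; rewrite mulr_ge0// subr_ge0 nonneg_ind_le1.
move=> z; rewrite nonneg_indE; have [z0|z0] := leP 0 z.
  by rewrite subrr mulr0.
by rewrite subr0 mulr1 ltr0_norm ?opprB ?lerBrDr; lra.
Qed.

End GaussianMass.

(** * One Gaussian replacement step *)

Section OneStep.
Context {R : realType}.
Local Notation mu := (@lebesgue_measure R).
Implicit Types (x y z m : R) (k g : R -> R).

Definition step_error_fun m z : R :=
  `|nonneg_ind z - halfmass m| * `|z - m|.

Definition step_error m : R := fine (normal_mean m (step_error_fun m)).

Lemma measurable_step_error_fun m : measurable_fun [set: R] (step_error_fun m).
Proof.
apply: measurable_funM; last exact: measurable_norm_sub.
apply: measurableT_comp => //; apply: measurable_funB => //.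
exact: measurable_nonneg_ind.
Qed.

Lemma step_error_fun_ge0 m z : 0 <= step_error_fun m z.
Proof. exact: mulr_ge0. Qed.

Lemma norm_ind_sub_le1 m z : `|nonneg_ind z - halfmass m| <= 1 :> R.
Proof.
have := halfmass_ge0 m; have := halfmass_le1 m.
by rewrite nonneg_indE ler_norml; case: (0 <= z) => /=; lra.
Qed.

Lemma normal_mean_step_error m : normal_mean m (step_error_fun m) = (step_error m)%:E.
Proof.
rewrite /step_error fineK// ge0_fin_numE; last first.
  by apply: normal_mean_ge0; exact: step_error_fun_ge0.
have [C _ hC] := @normal_mean_norm_bounded R.
apply: le_lt_trans (le_lt_trans (hC m) (ltry C)); apply: le_normal_mean.
- exact: measurable_step_error_fun.
- exact: measurable_norm_sub.
- exact: step_error_fun_ge0.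
- by move=> z; rewrite /step_error_fun ler_piMl// norm_ind_sub_le1.
Qed.

Lemma step_error_ge0 m : 0 <= step_error m.
Proof. by rewrite -lee_fin -normal_mean_step_error normal_mean_ge0//; exact: step_error_fun_ge0. Qed.

(** When [m] is large both the mass of the negative half line and the part of the
    first moment that it carries are of order [1 / m]. *)
Lemma step_error_bounded : exists2 C : R, 0 < C &
  forall m, 0 <= m -> step_error m <= C /\ m * step_error m <= C.
Proof.
have [C1 C10 hC1] := @normal_mean_norm_bounded R.
have [C2 C20 hC2] := @normal_mean_sqr_bounded R.
have [C3 C30 hC3] := @halfmassC_bounded R.
exists (C1 + (C3 * C1 + C2)) => [|m m0].
  by rewrite !addr_gt0// mulr_gt0.
have mn := @measurable_norm_sub R m.
have ms := @measurable_sqr_sub R m.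
split.
  apply: (@le_trans _ _ C1); last first.
    by rewrite lerDl addr_ge0// ?mulr_ge0// ltW.
  rewrite -lee_fin -normal_mean_step_error; apply: le_trans (hC1 m).
  apply: le_normal_mean.
  - exact: measurable_step_error_fun.
  - exact: mn.
  - exact: step_error_fun_ge0.
  - by move=> z; rewrite /step_error_fun ler_piMl// norm_ind_sub_le1.
apply: (@le_trans _ _ (C3 * C1 + C2)); last by rewrite lerDr ltW.
rewrite -lee_fin EFinM -normal_mean_step_error.
rewrite -normal_meanZ; [|exact: measurable_step_error_fun
                  |exact: step_error_fun_ge0|by []].
apply: (@le_trans _ _ (normal_mean m (fun z => C3 * `|z - m| + (z - m) ^+ 2)%R)).
  apply: le_normal_mean.
  - by apply: measurable_funM => //; exact: measurable_step_error_fun.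
  - by apply: measurable_funD => //; exact: measurable_funM.
  - by move=> z; rewrite mulr_ge0// step_error_fun_ge0.
  move=> z; rewrite /step_error_fun nonneg_indE.
  have h := hC3 m m0; have p0 := @halfmass_ge0 R m; have p1 := @halfmass_le1 R m.
  have [z0|z0] := leP 0 z => /=.
    rewrite ger0_norm ?subr_ge0// mulrA.
    by rewrite -[leLHS]addr0 lerD ?sqr_ge0// ler_wpM2r.
  rewrite sub0r normrN ger0_norm// ltr0_norm; last by lra.
  have : m * halfmass m * (m - z) <= m * 1 * (m - z).
    by rewrite ler_wpM2r ?ler_wpM2l//; lra.
  have : 0 <= C3 * (m - z) by rewrite mulr_ge0; lra.
  have : 0 <= - z * (m - z) by rewrite mulr_ge0; lra.
  nra.
rewrite normal_meanD//; first last.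
- by move=> z; exact: sqr_ge0.
- by move=> z; rewrite mulr_ge0// ltW.
- exact: measurable_funM.
rewrite normal_meanZ//; last exact: ltW.
by rewrite EFinD EFinM leeD// lee_wpmul2l// lee_fin ltW.
Qed.

(** Replacing the indicator of the half line by its mass costs only the oscillation
    of [g], since [nonneg_ind - halfmass m] has mean zero and kills the constant
    [q]. *)
Lemma half_line_replacement g m K q : measurable_fun [set: R] g -> (forall z, 0 <= g z) ->
  0 <= q -> 0 <= K -> (forall z, `|g z - q| <= K * `|z - m|) ->
  (normal_mean m (fun z => (nonneg_ind z * g z)%R) <=
     (halfmass m)%:E * normal_mean m g + (K * step_error m)%:E)%E /\
  ((halfmass m)%:E * normal_mean m g <=
     normal_mean m (fun z => (nonneg_ind z * g z)%R) + (K * step_error m)%:E)%E.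
Proof.
move=> mg gp q0 K0 gK.
have mi := @measurable_nonneg_ind R.
have me := measurable_step_error_fun m.
have p0 := @halfmass_ge0 R m.
have mig : measurable_fun [set: R] (fun z => nonneg_ind z * g z).
  exact: measurable_funM.
have mi0 : measurable_fun [set: R] (fun z => nonneg_ind z * q).
  exact: measurable_funM.
have mKe : measurable_fun [set: R] (fun z => K * step_error_fun m z).
  exact: measurable_funM.
have mpg : measurable_fun [set: R] (fun z => halfmass m * g z).
  exact: measurable_funM.
have ig_ge0 z : 0 <= nonneg_ind z * g z by rewrite mulr_ge0 ?nonneg_ind_ge0.
have i0_ge0 z : 0 <= nonneg_ind z * q by rewrite mulr_ge0 ?nonneg_ind_ge0.
have e_ge0 z : 0 <= K * step_error_fun m z by rewrite mulr_ge0 ?step_error_fun_ge0.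
have pg_ge0 z : 0 <= halfmass m * g z by rewrite mulr_ge0.
have pg0 : 0 <= halfmass m * q by rewrite mulr_ge0.
have Ei0 : normal_mean m (fun z => (nonneg_ind z * q)%R) = (halfmass m * q)%:E.
  rewrite (@eq_normal_mean _ _ _ (fun z => q * nonneg_ind z)); last first.
    by move=> z; rewrite mulrC.
  by rewrite normal_meanZ ?normal_mean_ind -?EFinM 1?mulrC// => z; exact: nonneg_ind_ge0.
have EKe : normal_mean m (fun z => (K * step_error_fun m z)%R) = (K * step_error m)%:E.
  by rewrite normal_meanZ ?normal_mean_step_error ?EFinM// => z; exact: step_error_fun_ge0.
have Epg : normal_mean m (fun z => (halfmass m * g z)%R) =
    ((halfmass m)%:E * normal_mean m g)%E by rewrite normal_meanZ.
have key z : `|(nonneg_ind z - halfmass m) * (g z - q)| <= K * step_error_fun m z.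
  by rewrite normrM /step_error_fun mulrCA ler_wpM2l.
(* The mean of [nonneg_ind z * q] is [halfmass m * q]: adding it on one side and
   the constant on the other keeps every integrand nonnegative. *)
split.
- rewrite -(leeD2rE _ _ (_ : (halfmass m * q)%:E \is a fin_num))//.
  rewrite -[X in (_ + X <= _)%E](@normal_mean_cst _ m)// -[X in (_ <= _ + X)%E]Ei0.
  rewrite -Epg -EKe -!normal_meanD//; last by move=> z; exact: addr_ge0.
    apply: le_normal_mean.
    + by apply: measurable_funD.
    + by apply: measurable_funD => //; apply: measurable_funD.
    + by move=> z; rewrite addr_ge0.
    move=> z; have := key z; rewrite ler_norml => /andP[_]; lra.
  exact: measurable_funD.
- rewrite -(leeD2rE _ _ (_ : (halfmass m * q)%:E \is a fin_num))//.
  rewrite -[X in (_ <= _ + X)%E](@normal_mean_cst _ m)// -[X in (_ + X <= _)%E]Ei0.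
  rewrite -Epg -EKe -!normal_meanD//; last by move=> z; exact: addr_ge0.
    apply: le_normal_mean.
    + by apply: measurable_funD.
    + by apply: measurable_funD => //; apply: measurable_funD.
    + by move=> z; rewrite addr_ge0.
    move=> z; have := key z; rewrite ler_norml => /andP[+ _]; lra.
  exact: measurable_funD.
Qed.

(** The Gaussian of centre [w] and variance [v], scaled to have maximum 1. *)
Definition gauss_bump v w x : R := expR (- ((x - w) ^+ 2 / (2 * v))).

Lemma gauss_bump_ge0 v w x : 0 <= gauss_bump v w x. Proof. exact: expR_ge0. Qed.

Lemma gauss_bump_le1 v w x : 0 < v -> gauss_bump v w x <= 1.
Proof.
move=> v0; rewrite /gauss_bump -[leRHS]expR0 ler_expR oppr_le0.
by rewrite mulr_ge0 ?sqr_ge0// invr_ge0 mulr_ge0// ltW.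
Qed.

Lemma measurable_gauss_bump v w : measurable_fun [set: R] (gauss_bump v w).
Proof.
apply: measurableT_comp => //=; apply: measurableT_comp => //.
by apply: measurable_funM => //; exact: measurable_sqr_sub.
Qed.

Lemma expR_half_sqr_lipschitz x y :
  `|expR (- (x ^+ 2 / 2)) - expR (- (y ^+ 2 / 2))| <= `|x - y| :> R.
Proof.
have half (u v : R) : 0 <= u -> u <= v ->
    expR (- (u ^+ 2 / 2)) - expR (- (v ^+ 2 / 2)) <= v - u :> R.
  move=> u0 uv; have [vu|vu] := leP 1 (v - u).
    apply: le_trans vu; rewrite lerBlDr (le_trans (y := 1))//.
      by rewrite -[leRHS]expR0 ler_expR oppr_le0 mulr_ge0 ?sqr_ge0.
    by rewrite lerDl expR_ge0.
  have -> : - (v ^+ 2 / 2) = - (u ^+ 2 / 2) - (v - u) * (v + u) / 2 :> R by field.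
  rewrite expRD -[X in X - _]mulr1 -mulrBr.
  (* Here [(u + v) / 2 <= u + 1 / 2], and [u + 1 / 2 <= 1 + u^2 / 2 <= exp (u^2 / 2)]. *)
  have h1 : 1 - expR (- ((v - u) * (v + u) / 2)) <= (v - u) * (u + 2^-1).
    rewrite lerBlDr -lerBlDl.
    apply: le_trans (expR_ge1Dx _); rewrite lerD2l lerN2 -mulrA ler_wpM2l//; lra.
  have h2 : expR (- (u ^+ 2 / 2)) * (u + 2^-1) <= 1.
    rewrite expRN mulrC ler_pdivrMr ?expR_gt0// mul1r.
    apply: le_trans (expR_ge1Dx _).
    by have := sqr_ge0 (u - 1); nra.
  apply: (le_trans (ler_wpM2l (expR_ge0 _) h1)).
  by rewrite mulrCA -[leRHS]mulr1 ler_wpM2l// subr_ge0.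
have lip (u v : R) : 0 <= u -> 0 <= v ->
    `|expR (- (u ^+ 2 / 2)) - expR (- (v ^+ 2 / 2))| <= `|u - v| :> R.
  wlog uv : u v / u <= v => [hw u0 v0|u0 v0].
    have [uv|/ltW vu] := leP u v; first exact: hw.
    by rewrite distrC [leRHS]distrC; exact: hw.
  rewrite ger0_norm; last first.
    by rewrite subr_ge0 ler_expR lerN2 ler_pM2r// lerXn2r ?nnegrE.
  by rewrite distrC [leRHS]ger0_norm ?subr_ge0// half.
rewrite -(@real_normK _ x) ?num_real// -(@real_normK _ y) ?num_real//.
by apply: le_trans (lip _ _ _ _) _ => //; exact: ler_dist_dist.
Qed.

Lemma gauss_bump_lipschitz v w x y : 0 < v ->
  `|gauss_bump v w x - gauss_bump v w y| <= (Num.sqrt v)^-1 * `|x - y|.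
Proof.
move=> v0; have s0 : 0 < Num.sqrt v by rewrite sqrtr_gt0.
have E t : gauss_bump v w t = expR (- (((t - w) / Num.sqrt v) ^+ 2 / 2)).
  rewrite /gauss_bump exprMn exprVn sqr_sqrtr ?ltW//; congr (expR (- _)).
  by field; rewrite gt_eqF.
rewrite !E; apply: le_trans (expR_half_sqr_lipschitz _ _) _.
rewrite -mulrBl normrM mulrC gtr0_norm ?invr_gt0//.
by rewrite (_ : x - w - (y - w) = x - y)//; ring.
Qed.

(** Gaussian convolution: variances add and centres shift. The integrand is the
    normal density of mean [M] and variance [s^2] up to a factor free of [z]. *)
Lemma normal_mean_gauss_bump v w y a m : 0 < v ->
  normal_mean m (fun z => gauss_bump v w (y + a * z)) =
  (Num.sqrt (v / (v + a ^+ 2)) * gauss_bump (v + a ^+ 2) (w - a * m) y)%:E.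
Proof.
move=> v0; pose V := v + a ^+ 2.
have V0 : 0 < V by rewrite ltr_wpDr ?sqr_ge0.
pose s : R := Num.sqrt (v / V).
have s0 : 0 < s by rewrite sqrtr_gt0 divr_gt0.
have s2 : s ^+ 2 = v / V by rewrite sqr_sqrtr// divr_ge0 ?ltW.
pose M := (v * m + a * (w - y)) / V.
have pk : normal_peak 1 = s * normal_peak s :> R.
  rewrite /normal_peak expr1n mul1r -mulrnAr sqrtrM ?sqr_ge0//.
  rewrite sqrtr_sqr gtr0_norm// invfM mulrA mulfV ?gt_eqF// mul1r.
  by [].
rewrite /normal_mean -/V -/s.
transitivity (\int[mu]_z ((s * gauss_bump V (w - a * m) y)%:E *
   (normal_pdf M s z)%:E))%E.
  apply: eq_integral => z _; rewrite -EFinM; congr (_%:E).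
  rewrite std_pdfE normal_pdfE ?gt_eqF// pk /gauss_bump /normal_fun.
  rewrite -[LHS]mulrA [RHS]mulrACA -!expRD; congr (_ * expR _).
  rewrite s2 -mulr_natr /M /V; field.
  by rewrite !gt_eqF.
rewrite ge0_integralZl//=.
- by rewrite integral_normal_pdf mule1.
- by apply/measurable_EFinP; exact: measurable_normal_pdf.
- by move=> z _; rewrite lee_fin normal_pdf_ge0.
- by rewrite lee_fin mulr_ge0 ?gauss_bump_ge0// ltW.
Qed.

End OneStep.

(** * Independence of partial sums and further variables *)

Section RectangleUniqueness.
Context d1 d2 (T1 : measurableType d1) (T2 : measurableType d2) (R : realType).

Lemma rectangle_unique (m1 m2 : {measure set (T1 * T2) -> \bar R}) :
  (m1 setT < +oo)%E ->
  (forall A B, measurable A -> measurable B -> m1 (A `*` B) = m2 (A `*` B)) ->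
  forall D, measurable D -> m1 D = m2 D.
Proof.
move=> m1oo m12 D mD.
pose C : set (set (T1 * T2)) :=
  [set C | exists A, measurable A /\ exists B, measurable B /\ C = A `*` B].
apply: (measure_unique C (fun=> setT)) => //.
- rewrite measurable_prod_measurableType //; congr (<<s _ >>).
  rewrite predeqE; split => [[A mA [B mB <-]]|[A [mA [B [mB ->]]]]].
    by exists A; split => //; exists B.
  by exists A => //; exists B.
- move=> /= _ _ [X1 [mX1 [X2 [mX2 ->]]]] [Y1 [mY1 [Y2 [mY2 ->]]]].
  rewrite -setXI; exists (X1 `&` Y1); split; first exact: measurableI.
  by exists (X2 `&` Y2); split => //; exact: measurableI.
- move=> n; exists setT; split => //; exists setT; split => //.
  by rewrite setXTT.
- by rewrite bigcup_const//; exact/set0P; exists 0%N.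
- by move=> A [A1 [mA1 [A2 [mA2 ->]]]]; exact: m12.
Qed.

End RectangleUniqueness.

Lemma measurable_normal_mean_param {R : realType} m (k : R * R -> R) :
  measurable_fun [set: R * R] k -> (forall x, 0 <= k x) ->
  measurable_fun [set: R] (fun x => normal_mean m (fun z => k (x, z))).
Proof.
move=> mk k0.
pose Rm := measurableTypeR R.
pose f (x : Rm * Rm) := (std_pdf (x.2 - m) * k x)%:E.
have mf : measurable_fun [set: Rm * Rm] f.
  apply/measurable_EFinP; apply: measurable_funM; last exact: mk.
  apply: (measurableT_comp (measurable_std_pdfB m)); exact: measurable_snd.
have f0 x : (0 <= f x)%E by rewrite lee_fin mulr_ge0 ?std_pdf_ge0.
have := @measurable_fun_fubini_tonelli_F _ _ Rm Rm R lebesgue_measure f mf f0.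
by move=> h mT A mA; exact: (h mT A mA).
Qed.

Section Independence.
Context d (T : measurableType d) (R : realType) (P : probability T R).
Variable Z : nat -> {RV P >-> R}.
Hypothesis hZ : iid_standard_normal Z.
Local Notation mu := (@lebesgue_measure R).

Lemma measurable_RV_preimage (X : {RV P >-> R}) (A : set R) :
  measurable A -> measurable (X @^-1` A).
Proof. by move=> mA; rewrite -[X in measurable X]setTI; exact: measurable_funP. Qed.

(** By independence the joint law is a product measure, so Tonelli's theorem allows
    the standard normal variable to be integrated first. *)
Lemma integrate_out (X : {RV P >-> R}) n (k : R * R -> R) :
  (forall A B, measurable A -> measurable B ->
    P (X @^-1` A `&` Z n @^-1` B) = (P (X @^-1` A) * P (Z n @^-1` B))%E) ->
  measurable_fun [set: R * R] k -> (forall x, 0 <= k x) ->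
  (\int[P]_t (k (X t, Z n t))%:E =
   \int[P]_t normal_mean 0 (fun z => k (X t, z)))%E.
Proof.
move=> XZ mk k0.
(* The Borel sets of [R] come with two displays; Lebesgue measure, hence the density,
   lives on the one of [Rm]. *)
pose Rm := measurableTypeR R.
have mX : measurable_fun [set: T] (X : T -> Rm).
  by move=> mT A mA; exact: (@measurable_funP _ _ _ _ setT X mT A mA).
have mZ : measurable_fun [set: T] (Z n : T -> Rm).
  by move=> mT A mA; exact: (@measurable_funP _ _ _ _ setT (Z n) mT A mA).
pose X' : {RV P >-> Rm} := HB.pack (X : T -> Rm) (isMeasurableFun.Build _ _ _ _ _ mX).
pose XZn t : Rm * Rm := (X t, Z n t).
have mXZ : measurable_fun [set: T] XZn by apply/measurable_fun_pairP; split.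
have mkE : measurable_fun [set: Rm * Rm] (EFin \o k : Rm * Rm -> \bar R).
  by apply/measurable_EFinP; exact: mk.
have kE0 x : (0 <= (EFin \o k) x)%E by rewrite lee_fin.
pose N01 : probability _ R := @normal_prob R 0 1.
transitivity (\int[image_measure P mXZ]_x (EFin \o k) x)%E.
  by rewrite ge0_integral_pushforward.
transitivity (\int[distribution P X' \x N01]_x (EFin \o k) x)%E.
  apply: eq_measure_integral => A mA _; apply/esym.
  apply: product_measure_unique => //= B C mB mC.
  have <- : distribution P (Z n) C = N01 C by exact: hZ.2.
  exact: XZ.
rewrite fubini_tonelli1//.
rewrite ge0_integral_pushforward//=; last 2 first.
- by apply: measurable_fun_fubini_tonelli_F.
- by move=> y _; apply: integral_ge0.
apply: eq_integral => t _ /=.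
rewrite /fubini_F integral_normal_prob//; last first.
  exact: measurableT_comp mkE (measurable_pair1 _).
by apply: eq_integral => z _; rewrite subr0 /= -EFinM mulrC.
Qed.

Lemma independent_fsetU1 n (J : {fset nat}) (A : nat -> set R) (V : set R) :
  n \notin J -> measurable V -> (forall j, j \in J -> measurable (A j)) ->
  P (Z n @^-1` V `&` \bigcap_(j in [set` J]) (Z j @^-1` A j)) =
  (P (Z n @^-1` V) * P (\bigcap_(j in [set` J]) (Z j @^-1` A j)))%E.
Proof.
move=> nJ mV mA.
pose A' j := if j == n then V else A j.
have A'J j : j \in J -> A' j = A j.
  by rewrite /A'; case: eqP => // ->; rewrite (negbTE nJ).
have mA' j : j \in (n |` J)%fset -> measurable (A' j).
  by rewrite in_fset1U /A'; case: eqP => //= _; exact: mA.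
have -> : Z n @^-1` V `&` \bigcap_(j in [set` J]) (Z j @^-1` A j) =
    \bigcap_(j in [set` (n |` J)%fset]) (Z j @^-1` A' j).
  apply/seteqP; split => [t [Vt Jt] j /=|t h].
    rewrite in_fset1U => /predU1P[->|jJ]; first by rewrite /A' eqxx.
    by rewrite A'J//; exact: Jt.
  split; first by have := h n; rewrite /= in_fset1U eqxx /A' eqxx; exact.
  by move=> j /= jJ; have := h j; rewrite /= in_fset1U jJ orbT A'J//; exact.
rewrite hZ.1// hZ.1// big_fsetU1//= {1}/A' eqxx; congr (_ * _)%E.
by rewrite !big_seq; apply: eq_bigr => j jJ; rewrite A'J.
Qed.

Variable c : nat -> R.

(** The variable [Z 0] is left out: it is kept to smooth the law of the whole sum. *)
Definition psum N t : R := \sum_(i < N) c i * `|Z i.+1 t|.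

Lemma psumS N t : psum N.+1 t = psum N t + c N * `|Z N.+1 t|.
Proof. by rewrite /psum big_ord_recr. Qed.

Lemma measurable_psum N : measurable_fun [set: T] (psum N).
Proof.
apply: measurable_sum => i; apply: measurable_funM => //.
by apply: measurableT_comp => //; exact: measurable_funP.
Qed.

Definition psum_RV N : {RV P >-> R} :=
  HB.pack (psum N) (isMeasurableFun.Build _ _ _ _ _ (measurable_psum N)).

(** Each step of the induction moves one variable from the family into the sum. The
    new sum is a function of the pair formed by the old sum and this variable; the
    law of the pair restricted to the event of the family is found on rectangles,
    where the induction hypothesis applies to a larger or a smaller family. *)
Lemma psum_independent N (J : {fset nat}) (A : nat -> set R) (B : set R) :
  (forall j, j \in J -> measurable (A j)) ->
  (forall j, j \in J -> j = 0%N \/ (N < j)%N) -> measurable B ->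
  P (psum N @^-1` B `&` \bigcap_(j in [set` J]) (Z j @^-1` A j)) =
  (P (psum N @^-1` B) * P (\bigcap_(j in [set` J]) (Z j @^-1` A j)))%E.
Proof.
elim: N J A B => [|N IH] J A B mA hJ mB.
  have -> : psum 0 = cst 0 by apply/funext => t; rewrite /psum big_ord0.
  rewrite preimage_cst; case: ifPn => _.
    by rewrite setTI probability_setT mul1e.
  by rewrite set0I measure0 mul0e.
set E := \bigcap_(j in _) _.
have mE : measurable E.
  by apply: fin_bigcap_measurable => // j Jj; apply: measurable_RV_preimage; exact: mA.
pose F t := (psum N t, Z N.+1 t).
have mF : measurable_fun [set: T] F.
  by apply/measurable_fun_pairP; split => //; exact: measurable_psum.
have PE : 0 <= fine (P E) by exact: fine_ge0.
have PEfin : P E = (fine (P E))%:E by rewrite fineK// fin_num_measure.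
pose m1 := image_measure (mrestr P mE) mF.
pose m2 := mscale (NngNum PE) (image_measure P mF).
have m12 D : measurable D -> m1 D = m2 D.
  apply: rectangle_unique => [|U V mU mV].
    rewrite /m1/= /pushforward/= preimage_setT /mrestr/= setTI.
    by rewrite -ge0_fin_numE// fin_num_measure.
  have NJ : N.+1 \notin J by apply/negP => /hJ[//|]; rewrite ltnn.
  pose A' j := if j == N.+1 then V else A j.
  have A'J j : j \in J -> A' j = A j.
    by rewrite /A'; case: eqP => // ->; rewrite (negbTE NJ).
  have mA' j : j \in (N.+1 |` J)%fset -> measurable (A' j).
    by rewrite in_fset1U /A'; case: eqP => //= _; exact: mA.
  have bigE : \bigcap_(j in [set` (N.+1 |` J)%fset]) (Z j @^-1` A' j) =
      Z N.+1 @^-1` V `&` E.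
    apply/seteqP; split => [t h|t [Vt Jt] j /=]; last first.
      rewrite in_fset1U => /predU1P[->|jJ]; first by rewrite /A' eqxx.
      by rewrite A'J//; exact: Jt.
    split; first by have := h N.+1; rewrite /= in_fset1U eqxx /A' eqxx; exact.
    by move=> j /= jJ; have := h j; rewrite /= in_fset1U jJ orbT A'J//; exact.
  have big1E : \bigcap_(j in [set` [fset N.+1]%fset]) (Z j @^-1` V) =
      Z N.+1 @^-1` V.
    apply/seteqP; split => [t h|t Vt j /=]; first by apply: h; rewrite /= inE.
    by rewrite inE => /eqP ->.
  transitivity (P (psum N @^-1` U `&` (Z N.+1 @^-1` V `&` E))).
    by rewrite setIA.
  rewrite -bigE IH//; last first.
    move=> j; rewrite in_fset1U => /predU1P[->|/hJ[->|/ltnW]]; first by right.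
      by left.
    by right.
  rewrite bigE independent_fsetU1//.
  transitivity (P E * P (psum N @^-1` U `&` Z N.+1 @^-1` V))%E; last first.
    by rewrite [in LHS]PEfin.
  rewrite -big1E IH//; last first.
    by move=> j; rewrite inE => /eqP ->; right.
  by rewrite big1E muleA muleC.
pose D := [set x : R * R | B (x.1 + c N * `|x.2|)].
have mD : measurable D.
  have mf : measurable_fun [set: R * R] (fun x : R * R => x.1 + c N * `|x.2|).
    apply: measurable_funD; first exact: measurable_fst.
    by apply: measurable_funM => //; exact: measurableT_comp.
  by rewrite -[D]setTI; exact: mf.
have psumE : psum N.+1 @^-1` B = F @^-1` D.
  by apply/seteqP; split => t; rewrite /D /F/= psumS.
have := m12 D mD.
rewrite /m1 /m2/= /mscale/= /pushforward/= /mrestr/= -PEfin psumE => ->.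
by rewrite muleC.
Qed.

Lemma psum_independent1 N n (A B : set R) : n = 0%N \/ (N < n)%N ->
  measurable A -> measurable B ->
  P (psum N @^-1` A `&` Z n @^-1` B) =
  (P (psum N @^-1` A) * P (Z n @^-1` B))%E.
Proof.
move=> Nn mA mB.
have <- : \bigcap_(j in [set` [fset n]%fset]) (Z j @^-1` B) = Z n @^-1` B.
  apply/seteqP; split => [t h|t Vt j /=]; first by apply: h; rewrite /= inE.
  by rewrite inE => /eqP ->.
by apply: (@psum_independent N [fset n]%fset (fun=> B)) => // j; rewrite inE => /eqP ->.
Qed.

Lemma integrate_out_psum N n (k : R * R -> R) : n = 0%N \/ (N < n)%N ->
  measurable_fun [set: R * R] k -> (forall x, 0 <= k x) ->
  (\int[P]_t (k (psum N t, Z n t))%:E =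
   \int[P]_t normal_mean 0 (fun z => k (psum N t, z)))%E.
Proof.
move=> Nn mk k0; apply: (@integrate_out (psum_RV N) n k) => // A B mA mB.
exact: psum_independent1.
Qed.

End Independence.

(** * The tilted law of a partial sum *)

Section Tilting.
Context d (T : measurableType d) (R : realType) (P : probability T R).
Variable Z : nat -> {RV P >-> R}.
Hypothesis hZ : iid_standard_normal Z.
Variables (c : nat -> R) (s : R).
Hypotheses (c_ge0 : forall i, 0 <= c i) (s_ge0 : 0 <= s).

Implicit Types (f g : R -> R) (x v w : R) (N : nat).

Definition sqsum N : R := \sum_(i < N) c i ^+ 2.

(** Multiplied by [exp (s^2 * sqsum N / 2)], the Laplace transform of the partial sum
    at [s]. *)
Definition halfmass_prod N : R := \prod_(i < N) (2 * halfmass (s * c i)).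

Definition error_sum N : R := \sum_(i < N) 2 * (c i * step_error (s * c i)).

(** The tilt is normalized by the Laplace transform of a normal variable of variance
    [sqsum N], so that its total mass is [halfmass_prod N] and not 1. *)
Definition tilt N x : R := expR (s * x - s ^+ 2 * sqsum N / 2).

Definition tilted_mean N (f : R -> R) : \bar R :=
  (\int[P]_t (tilt N (psum Z c N t) * f (psum Z c N t))%:E)%E.

Lemma sqsumS N : sqsum N.+1 = sqsum N + c N ^+ 2.
Proof. by rewrite /sqsum big_ord_recr. Qed.

Lemma sqsum_ge0 N : 0 <= sqsum N.
Proof. by apply: sumr_ge0 => i _; exact: sqr_ge0. Qed.

Lemma error_sumS N :
  error_sum N.+1 = error_sum N + 2 * (c N * step_error (s * c N)).
Proof. by rewrite /error_sum big_ord_recr. Qed.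

Lemma error_sum_ge0 N : 0 <= error_sum N.
Proof. by apply: sumr_ge0 => i _; rewrite !mulr_ge0// step_error_ge0. Qed.

Lemma halfmass_prodS N :
  halfmass_prod N.+1 = halfmass_prod N * (2 * halfmass (s * c N)).
Proof. by rewrite /halfmass_prod big_ord_recr. Qed.

Lemma halfmass_factor_ge1 i : 1 <= 2 * halfmass (s * c i).
Proof.
have := @halfmass_ge_half R (s * c i) (mulr_ge0 s_ge0 (c_ge0 i)).
by rewrite -(ler_pM2l (_ : 0 < 2)) ?mulfV.
Qed.

Lemma halfmass_prod_gt0 N : 0 < halfmass_prod N.
Proof.
apply: prodr_gt0 => i _.
by rewrite (lt_le_trans ltr01)// halfmass_factor_ge1.
Qed.

Lemma halfmass_prod_mono M N : (M <= N)%N -> halfmass_prod M <= halfmass_prod N.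
Proof.
move=> /subnK <-; elim: (N - M)%N => [|k IH]; first by rewrite add0n.
rewrite addSn halfmass_prodS (le_trans IH)// ler_peMr ?halfmass_factor_ge1//.
exact: ltW (halfmass_prod_gt0 _).
Qed.

Lemma measurable_tilt N : measurable_fun [set: R] (tilt N).
Proof.
by apply: measurableT_comp => //=; exact: measurable_funB.
Qed.

Lemma measurable_psum_tilt N (f : R -> R) : measurable_fun [set: R] f ->
  measurable_fun [set: T] (fun t => tilt N (psum Z c N t) * f (psum Z c N t)).
Proof.
move=> mf; apply: measurable_funM.
  by apply: measurableT_comp (measurable_tilt N) _; exact: measurable_psum.
by apply: measurableT_comp mf _; exact: measurable_psum.
Qed.

Lemma le_tilted_mean N f g : measurable_fun [set: R] f ->
  measurable_fun [set: R] g -> (forall x, 0 <= f x) ->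
  (forall x, f x <= g x) -> (tilted_mean N f <= tilted_mean N g)%E.
Proof.
move=> mf mg f0 fg; apply: ge0_le_integral => //=.
- by move=> t _; rewrite lee_fin mulr_ge0 ?expR_ge0.
- by apply/measurable_EFinP; exact: measurable_psum_tilt.
- by apply/measurable_EFinP; exact: measurable_psum_tilt.
- by move=> t _; rewrite lee_fin ler_wpM2l ?expR_ge0.
Qed.

Lemma tilted_mean_affine N f (k l : R) : measurable_fun [set: R] f ->
  (forall x, 0 <= f x) -> 0 <= k -> 0 <= l ->
  tilted_mean N (fun x => k * f x + l) =
  (k%:E * tilted_mean N f + l%:E * tilted_mean N (fun=> 1%R))%E.
Proof.
move=> mf f0 k0 l0.
have m1 := measurable_psum_tilt N mf.
have m2 : measurable_fun [set: T] (fun t => tilt N (psum Z c N t) * 1).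
  by apply: (@measurable_psum_tilt N (fun=> 1)).
rewrite /tilted_mean -!ge0_integralZl//=; first last.
- by move=> t _; rewrite lee_fin mulr_ge0 ?expR_ge0.
- by apply/measurable_EFinP.
- by move=> t _; rewrite lee_fin mulr_ge0 ?expR_ge0.
- by apply/measurable_EFinP.
rewrite -ge0_integralD//=.
- apply: eq_integral => t _; rewrite -!EFinM -EFinD; congr (_%:E).
  by ring.
- by move=> t _; rewrite lee_fin !mulr_ge0 ?expR_ge0.
- by apply/measurable_EFinP; exact: measurable_funM.
- by move=> t _; rewrite lee_fin !mulr_ge0 ?expR_ge0.
- by apply/measurable_EFinP; exact: measurable_funM.
Qed.

Lemma tilted_mean0 f : tilted_mean 0 f = (f 0)%:E.
Proof.
rewrite /tilted_mean (eq_integral (cst (f 0)%:E)) => [|t _]; last first.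
  rewrite /psum big_ord0 /tilt /sqsum big_ord0 !mulr0 mul0r subr0.
  by rewrite expR0 mul1r.
by rewrite integral_cst//= probability_setT mule1.
Qed.

Lemma tilted_meanS N f : measurable_fun [set: R] f -> (forall x, 0 <= f x) ->
  tilted_mean N.+1 f = (\int[P]_t ((2 * tilt N (psum Z c N t))%:E *
    normal_mean (s * c N) (fun z => nonneg_ind z * f (psum Z c N t + c N * z))%R))%E.
Proof.
move=> mf f0.
pose k (x : R * R) := tilt N.+1 (x.1 + c N * `|x.2|) * f (x.1 + c N * `|x.2|).
have madd : measurable_fun [set: R * R] (fun x : R * R => x.1 + c N * `|x.2|).
  apply: measurable_funD; first exact: measurable_fst.
  by apply: measurable_funM => //; exact: measurableT_comp.
have mk : measurable_fun [set: R * R] k.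
  apply: measurable_funM.
    exact: measurableT_comp (measurable_tilt _) madd.
  exact: measurableT_comp mf madd.
have k0 (y : R * R) : 0 <= k y by rewrite mulr_ge0 ?expR_ge0.
transitivity (\int[P]_t (k (psum Z c N t, Z N.+1 t))%:E)%E.
  by apply: eq_integral => t _; rewrite /k/= psumS.
rewrite (integrate_out_psum hZ)//; last by right.
apply: eq_integral => t _.
have mfx : measurable_fun [set: R] (fun z => f (psum Z c N t + c N * z)).
  by apply: measurableT_comp mf _; apply: measurable_funD => //; exact: measurable_funM.
rewrite EFinM -muleA muleCA -(@normal_mean_fold R _ (fun z => f (psum Z c N t + c N * z)))//.
rewrite -normal_meanZ ?expR_ge0//.
- apply: eq_normal_mean => z; rewrite /k/= mulrA -expRD; congr (expR _ * _).
  by rewrite sqsumS; field.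
- apply: measurable_funM; last first.
    apply: measurableT_comp mf _; apply: measurable_funD => //.
    by apply: measurable_funM => //; exact: measurableT_comp.
  apply: measurableT_comp => //; apply: measurable_funB => //.
  by apply: measurable_funM => //; exact: measurableT_comp.
- by move=> z; rewrite mulr_ge0 ?expR_ge0.
Qed.

Lemma tilted_mean1 N : tilted_mean N (fun=> 1) = (halfmass_prod N)%:E.
Proof.
elim: N => [|N IH]; first by rewrite tilted_mean0 /halfmass_prod big_ord0.
rewrite tilted_meanS// halfmass_prodS (mulrC (halfmass_prod N)) [RHS]EFinM -IH /tilted_mean.
rewrite -ge0_integralZl//=.
- apply: eq_integral => t _; rewrite (@eq_normal_mean _ _ _ nonneg_ind); last first.
    by move=> z; rewrite mulr1.
  by rewrite normal_mean_ind -!EFinM; congr (_%:E); ring.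
- by apply/measurable_EFinP; exact: (@measurable_psum_tilt N (fun=> 1)).
- by move=> t _; rewrite lee_fin mulr_ge0 ?expR_ge0.
- by rewrite lee_fin (le_trans ler01)// halfmass_factor_ge1.
Qed.

(** The mean of [gauss_bump v w] under the normal law of mean [s * sqsum N] and variance
    [sqsum N]. *)
Definition bump_limit N v w : R :=
  Num.sqrt (v / (v + sqsum N)) * gauss_bump (v + sqsum N) (w - s * sqsum N) 0.

Lemma bump_limitS N v w : 0 < v ->
  bump_limit N.+1 v w =
  Num.sqrt (v / (v + c N ^+ 2)) * bump_limit N (v + c N ^+ 2) (w - s * c N ^+ 2).
Proof.
move=> v0; have v'0 : 0 < v + c N ^+ 2 by rewrite ltr_wpDr ?sqr_ge0.
have vN : 0 < v + c N ^+ 2 + sqsum N by rewrite ltr_wpDr ?sqsum_ge0.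
rewrite /bump_limit mulrA -sqrtrM ?divr_ge0 ?ltW//; congr (Num.sqrt _ * gauss_bump _ _ _).
- by rewrite sqsumS; field; rewrite !gt_eqF.
- by rewrite sqsumS; ring.
- by rewrite sqsumS mulrDr; ring.
Qed.

(** Under the tilted law the partial sum is nearly normal with mean [s * sqsum N]
    and variance [sqsum N]. The sum is compared with a Gaussian one step at a
    time, in the manner of Lindeberg: Gaussian bumps are stable under the Gaussian
    step, so they serve as test functions all along the induction. *)
Lemma tilted_mean_gauss_bump N v w : 0 < v ->
  (tilted_mean N (gauss_bump v w) <=
    (halfmass_prod N * (bump_limit N v w + error_sum N / Num.sqrt v))%:E)%E /\
  ((halfmass_prod N * bump_limit N v w)%:E <= tilted_mean N (gauss_bump v w) +
    (halfmass_prod N * (error_sum N / Num.sqrt v))%:E)%E.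
Proof.
elim: N v w => [|N IH] v w v0.
  rewrite tilted_mean0 /halfmass_prod /error_sum /bump_limit /sqsum !big_ord0.
  rewrite !(mul0r, addr0, mulr0, subr0, mul1r) divff ?gt_eqF// sqrtr1 !mul1r.
  by split.
pose a := c N; pose m := s * a; pose v' := v + a ^+ 2; pose w' := w - a * m.
have v'0 : 0 < v' by rewrite ltr_wpDr ?sqr_ge0.
have [IHu IHl] := IH v' w' v'0.
pose K := (Num.sqrt v)^-1 * a; pose kap := Num.sqrt (v / v').
have K0 : 0 <= K by rewrite mulr_ge0 ?invr_ge0 ?sqrtr_ge0//; exact: c_ge0.
have kap0 : 0 <= kap by exact: sqrtr_ge0.
have e0 : 0 <= step_error m by exact: step_error_ge0.
have p1 := halfmass_factor_ge1 N; rewrite -/a -/m in p1.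
have h0 := halfmass_prod_gt0 N.
have step x :
    (2%:E * normal_mean m (fun z => nonneg_ind z * gauss_bump v w (x + a * z))%R <=
      (2 * halfmass m * kap * gauss_bump v' w' x + 2 * (K * step_error m))%:E)%E /\
    ((2 * halfmass m * kap * gauss_bump v' w' x)%:E <=
      2%:E * normal_mean m (fun z => nonneg_ind z * gauss_bump v w (x + a * z))%R +
       (2 * (K * step_error m))%:E)%E.
  have mg : measurable_fun [set: R] (fun z => gauss_bump v w (x + a * z)).
    apply: measurableT_comp; first exact: measurable_gauss_bump.
    by apply: measurable_funD => //; exact: measurable_funM.
  have lipg z : `|gauss_bump v w (x + a * z) - gauss_bump v w (x + a * m)| <= K * `|z - m|.
    apply: le_trans (gauss_bump_lipschitz _ _ _ v0) _.
    rewrite (_ : _ - _ = a * (z - m)); last by ring.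
    by rewrite normrM (ger0_norm (c_ge0 N)) mulrA.
  have [u l] := half_line_replacement mg (fun z => gauss_bump_ge0 _ _ _) (gauss_bump_ge0 v w (x + a * m)) K0 lipg.
  rewrite normal_mean_gauss_bump// -EFinM -/v' -/kap -/w' in u l.
  split.
    rewrite -EFinD in u.
    apply: le_trans (lee_wpmul2l _ u) _; first by rewrite lee_fin.
    by rewrite -EFinM lee_fin mulrDr !mulrA.
  rewrite (_ : 2 * halfmass m * kap * gauss_bump v' w' x =
    2 * (halfmass m * (kap * gauss_bump v' w' x))); last by ring.
  rewrite EFinM (EFinM 2 (K * _)) -muleDr//; last first.
    apply: ge0_adde_def; rewrite inE; last by rewrite lee_fin mulr_ge0.
    by apply: normal_mean_ge0 => z; rewrite mulr_ge0 ?nonneg_ind_ge0 ?gauss_bump_ge0.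
  by rewrite lee_wpmul2l ?lee_fin.
have mbump := @measurable_gauss_bump R.
have bump0 := @gauss_bump_ge0 R.
(* One step maps the test function to [k * gauss_bump v' w'], up to the error [l]. *)
pose k := 2 * halfmass m * kap; pose l := 2 * (K * step_error m).
have k0 : 0 <= k by rewrite !mulr_ge0// halfmass_ge0.
have l0 : 0 <= l by apply: mulr_ge0 => //; exact: mulr_ge0.
have tailE : bump_limit N.+1 v w = kap * bump_limit N v' w'.
  by rewrite bump_limitS//; congr (_ * bump_limit _ _ _); rewrite /w' /m /a; ring.
have sv0 : 0 < Num.sqrt v by rewrite sqrtr_gt0.
(* The Lipschitz constants decrease along the induction, so the errors of all steps
   are measured against the initial one. *)
have kapv : kap / Num.sqrt v' <= (Num.sqrt v)^-1.
  have sv2 : Num.sqrt v ^+ 2 = v by rewrite sqr_sqrtr ?(ltW v0).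
  have sv'2 : Num.sqrt v' ^+ 2 = v' by rewrite sqr_sqrtr ?(ltW v'0).
  rewrite /kap sqrtrM ?(ltW v0)// sqrtrV ?(ltW v'0)// -mulrA -invfM -expr2 sv'2.
  rewrite ler_pdivrMr// mulrC ler_pdivlMr// -expr2 sv2.
  by rewrite lerDl sqr_ge0.
have err_bound : 2 * halfmass m * kap * (halfmass_prod N * (error_sum N / Num.sqrt v')) +
    l * halfmass_prod N <= halfmass_prod N.+1 * (error_sum N.+1 / Num.sqrt v).
  rewrite halfmass_prodS error_sumS -/a -/m.
  have -> : 2 * halfmass m * kap * (halfmass_prod N * (error_sum N / Num.sqrt v')) =
    halfmass_prod N * (2 * halfmass m) * (error_sum N * (kap / Num.sqrt v')) by ring.
  rewrite [leRHS](_ : _ = halfmass_prod N * (2 * halfmass m) *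
      (error_sum N * (Num.sqrt v)^-1) + halfmass_prod N * (2 * halfmass m) * l);
    last by rewrite /l /K; ring.
  apply: lerD.
    apply: ler_wpM2l; first by rewrite !mulr_ge0 ?halfmass_ge0// ltW.
    by apply: ler_wpM2l kapv; exact: error_sum_ge0.
  rewrite mulrC -[leRHS]mulrA; apply: ler_wpM2l; first exact: ltW.
  by rewrite ler_peMl.
have WS := tilted_meanS N (mbump v w) (bump0 v w).
pose G x := normal_mean m (fun z => nonneg_ind z * gauss_bump v w (x + a * z)).
have G0 x : (0 <= G x)%E.
  by apply: normal_mean_ge0 => z; rewrite mulr_ge0 ?nonneg_ind_ge0.
have mG : measurable_fun [set: R] G.
  pose k' (x : R * R) := nonneg_ind x.2 * gauss_bump v w (x.1 + a * x.2).
  have mk' : measurable_fun [set: R * R] k'.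
    apply: measurable_funM.
      by apply: measurableT_comp (@measurable_nonneg_ind R) _; exact: measurable_snd.
    apply: measurableT_comp (mbump v w) _; apply: measurable_funD.
      exact: measurable_fst.
    by apply: measurable_funM => //; exact: measurable_snd.
  have k'0 (y : R * R) : 0 <= k' y by rewrite mulr_ge0 ?nonneg_ind_ge0.
  exact: (measurable_normal_mean_param m mk' k'0).
have mtilt := @measurable_psum_tilt N (fun=> 1) (measurable_cst _).
have mW : measurable_fun [set: T]
    (fun t => (2 * tilt N (psum Z c N t))%:E * G (psum Z c N t))%E.
  apply: emeasurable_funM; last by apply: measurableT_comp mG _; exact: measurable_psum.
  apply/measurable_EFinP; apply: measurable_funM => //.
  by apply: measurableT_comp (measurable_tilt N) _; exact: measurable_psum.
have W0 t : (0 <= (2 * tilt N (psum Z c N t))%:E * G (psum Z c N t))%E.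
  by rewrite mule_ge0// lee_fin mulr_ge0 ?expR_ge0.
have mtl : measurable_fun [set: T] (fun t => (l * tilt N (psum Z c N t))%:E).
  apply/measurable_EFinP; apply: measurable_funM => //.
  by apply: measurableT_comp (measurable_tilt N) _; exact: measurable_psum.
have mkl : measurable_fun [set: R] (fun x => k * gauss_bump v' w' x + l).
  by apply: measurable_funD => //; exact: measurable_funM.
split.
- have : (tilted_mean N.+1 (gauss_bump v w) <=
      tilted_mean N (fun x => k * gauss_bump v' w' x + l)%R)%E.
    rewrite WS; apply: ge0_le_integral => //=.
    + by apply/measurable_EFinP; exact: (measurable_psum_tilt N mkl).
    + move=> t _; have [u _] := step (psum Z c N t).
      rewrite mulrC EFinM -muleA (EFinM (tilt _ _)).
      by rewrite lee_wpmul2l ?lee_fin ?expR_ge0.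
  move/le_trans; apply.
  rewrite tilted_mean_affine// tilted_mean1.
  apply: le_trans (leeD2r _ (lee_wpmul2l _ IHu)) _; first by rewrite lee_fin.
  rewrite -!EFinM -EFinD lee_fin tailE.
  apply: le_trans (_ : _ <= k * halfmass_prod N * bump_limit N v' w' +
     (k * (halfmass_prod N * (error_sum N / Num.sqrt v')) + l * halfmass_prod N)) _.
    by rewrite le_eqVlt; apply/orP; left; apply/eqP; ring.
  rewrite [leRHS]mulrDr; apply: lerD; last exact: err_bound.
  by rewrite halfmass_prodS -/a -/m /k le_eqVlt; apply/orP; left; apply/eqP; ring.
- have A : (k%:E * tilted_mean N (gauss_bump v' w') <=
      tilted_mean N.+1 (gauss_bump v w) + (l * halfmass_prod N)%:E)%E.
    have -> : (k%:E * tilted_mean N (gauss_bump v' w') =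
       tilted_mean N (fun x => k * gauss_bump v' w' x + 0)%R)%E.
      by rewrite tilted_mean_affine// mul0e adde0.
    have -> : (l * halfmass_prod N)%:E =
        (\int[P]_t (l * tilt N (psum Z c N t))%:E)%E.
      rewrite EFinM -tilted_mean1 /tilted_mean -ge0_integralZl//=.
      + by apply: eq_integral => t _; rewrite mulr1.
      + by apply/measurable_EFinP.
      + by move=> t _; rewrite lee_fin mulr1 expR_ge0.
    rewrite WS -ge0_integralD//=; last first.
      by move=> t _; rewrite lee_fin mulr_ge0 ?expR_ge0.
    apply: ge0_le_integral => //=.
    + move=> t _; rewrite lee_fin addr0; apply: mulr_ge0; first exact: expR_ge0.
      exact: mulr_ge0.
    + apply/measurable_EFinP; apply: (@measurable_psum_tilt N (fun x => k * gauss_bump v' w' x + 0)).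
      by apply: measurable_funD => //; exact: measurable_funM.
    + exact: emeasurable_funD.
    + move=> t _; have [_ u] := step (psum Z c N t).
      set tau := tilt _ _; rewrite addr0 (EFinM tau) (mulrC 2) (EFinM tau 2) -muleA.
      rewrite (mulrC l) (EFinM tau l).
      rewrite -muleDr//; last first.
        apply: ge0_adde_def; rewrite inE ?lee_fin//.
        by apply: mule_ge0; [rewrite lee_fin|exact: G0].
      by rewrite lee_wpmul2l ?lee_fin ?expR_ge0.
  rewrite tailE.
  have -> : (halfmass_prod N.+1 * (kap * bump_limit N v' w'))%:E =
      (k%:E * (halfmass_prod N * bump_limit N v' w')%:E)%E.
    by rewrite -EFinM halfmass_prodS -/a -/m /k; congr (_%:E); ring.
  apply: le_trans (lee_wpmul2l _ IHl) _; first by rewrite lee_fin.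
  rewrite muleDr//; last by rewrite fin_num_adde_defl.
  rewrite -EFinM; apply: le_trans (leeD2r _ A) _.
  rewrite -addeA -EFinD leeD2l// lee_fin addrC.
  exact: err_bound.
Qed.

End Tilting.

(** * The density of a partial sum *)

Lemma measurable_natmul_bool d (T : measurableType d) (R : realType) (b : T -> bool) :
  measurable_fun [set: T] b -> measurable_fun [set: T] (fun x => (b x)%:R : R).
Proof.
move=> mb; rewrite (_ : (fun x => _) = (fun x => if b x then 1 else 0)).
  exact: measurable_fun_ifT.
by apply/funext => x; case: (b x).
Qed.

Section Density.
Context d (T : measurableType d) (R : realType) (P : probability T R).
Variable Z : nat -> {RV P >-> R}.
Hypothesis hZ : iid_standard_normal Z.
Local Notation mu := (@lebesgue_measure R).
Variables (alpha : R) (c : nat -> R).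
Hypothesis alpha_gt0 : 0 < alpha.
Implicit Types (x r s : R) (N : nat).

(** The density at [s] of [alpha * |Z| + x], with [Z] standard normal. *)
Definition density_fun s x : R :=
  2 / alpha * std_pdf ((s - x) / alpha) * nonneg_ind (s - x).

Definition density N s : \bar R := (\int[P]_t (density_fun s (psum Z c N t))%:E)%E.

Lemma density_fun_ge0 s x : 0 <= density_fun s x.
Proof. by rewrite /density_fun !mulr_ge0 ?std_pdf_ge0 ?nonneg_ind_ge0 ?invr_ge0// ltW. Qed.

Lemma density_ge0 N s : (0 <= density N s)%E.
Proof. by apply: integral_ge0 => t _; rewrite lee_fin density_fun_ge0. Qed.

Lemma measurable_density_fun2 :
  measurable_fun [set: R * R] (fun y : R * R => density_fun y.2 y.1).
Proof.
have mB : measurable_fun [set: R * R] (fun y : R * R => y.2 - y.1).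
  by apply: measurable_funB; [exact: measurable_snd|exact: measurable_fst].
apply: measurable_funM; last first.
  exact: measurableT_comp (@measurable_nonneg_ind R) mB.
apply: measurable_funM => //; apply: measurableT_comp (@measurable_std_pdf R) _.
exact: measurable_funM.
Qed.

Let Rm := measurableTypeR R.

Let mdens2 N : measurable_fun [set: T * Rm]
  (fun y : T * Rm => (density_fun y.2 (psum Z c N y.1))%:E).
Proof.
apply/measurable_EFinP.
pose g (y : T * Rm) : R * R := (psum Z c N y.1, y.2).
have mg : measurable_fun [set: T * Rm] g.
  apply/measurable_fun_pairP; split.
    by apply: measurableT_comp (measurable_psum Z c N) _; exact: measurable_fst.
  exact: (@measurable_snd _ _ T Rm).
exact: measurableT_comp measurable_density_fun2 mg.
Qed.

Let dens2_ge0 N (y : T * Rm) : (0 <= (density_fun y.2 (psum Z c N y.1))%:E)%E.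
Proof. by rewrite lee_fin density_fun_ge0. Qed.

Lemma measurable_density N : measurable_fun [set: Rm] (density N).
Proof.
exact: (@measurable_fun_fubini_tonelli_G _ _ T Rm R P _ (mdens2 N) (dens2_ge0 N)).
Qed.

Lemma normal_mean_tail r x :
  normal_mean 0 (fun z => (r < alpha * `|z| + x)%R%:R) =
  (\int[mu]_(s in `]r, +oo[) (density_fun s x)%:E)%E.
Proof.
pose k z : R := (r < alpha * z + x)%R%:R.
have mk : measurable_fun [set: R] k.
  apply: measurable_natmul_bool; apply: measurable_fun_ltr => //.
  by apply: measurable_funD => //; exact: measurable_funM.
have k0 z : 0 <= k z by exact: ler0n.
rewrite (@eq_normal_mean _ _ _ (fun z => expR (0 * `|z| - 0 ^+ 2 / 2) * k `|z|)); last first.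
  by move=> z; rewrite mul0r expr0n/= mul0r subr0 expR0 mul1r.
rewrite normal_mean_fold// /normal_mean.
pose F z := (std_pdf (z - 0) * (nonneg_ind z * k z))%:E : \bar R.
have mF : measurable_fun [set: R] F.
  by apply: measurable_normal_mean; apply: measurable_funM => //; exact: measurable_nonneg_ind.
have F0 z : (0 <= F z)%E.
  by rewrite lee_fin !mulr_ge0 ?std_pdf_ge0 ?nonneg_ind_ge0.
have ia : 0 < alpha^-1 by rewrite invr_gt0.
rewrite (integral_affine (- x / alpha) ia mF F0).
rewrite muleA -EFinM -ge0_integralZl//=; first last.
- by rewrite lee_fin divr_ge0// ltW.
- apply: measurableT_comp mF _; apply: measurable_funD => //.
rewrite [RHS]integral_mkcond; apply: eq_integral => s _.
rewrite patchE mem_setE in_itv/= andbT /F /density_fun subr0.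
have -> : alpha^-1 * s + - x / alpha = (s - x) / alpha by ring.
have -> : nonneg_ind ((s - x) / alpha) = nonneg_ind (s - x) :> R.
  by rewrite !nonneg_indE pmulr_lge0.
have -> : k ((s - x) / alpha) = (r < s)%R%:R.
  by rewrite /k (_ : alpha * _ + x = s)//; field; rewrite gt_eqF.
case: (r < s) => /=; rewrite ?mulr0 ?mule0// mulr1 -EFinM; congr (_%:E).
by ring.
Qed.

(** Integrating [Z 0] first gives the sum a density, the mean of [density_fun]. *)
Lemma tail_density N r :
  P [set t | r < alpha * `|Z 0 t| + psum Z c N t] =
  (\int[mu]_(s in `]r, +oo[) density N s)%E.
Proof.
pose k (y : R * R) : R := (r < alpha * `|y.2| + y.1)%R%:R.
have mk : measurable_fun [set: R * R] k.
  apply: measurable_natmul_bool; apply: measurable_fun_ltr => //.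
  apply: measurable_funD; last exact: measurable_fst.
  by apply: measurable_funM => //; exact: measurableT_comp.
have k0 y : 0 <= k y by exact: ler0n.
have mXZ : measurable_fun [set: T] (fun t => k (psum Z c N t, Z 0 t)).
  apply: measurableT_comp mk _; apply/measurable_fun_pairP; split => //.
  exact: measurable_psum.
transitivity (\int[P]_t (k (psum Z c N t, Z 0%N t))%:E)%E.
  rewrite (eq_integral (EFin \o \1_[set t | r < alpha * `|Z 0%N t| + psum Z c N t])).
    rewrite integral_indic ?setIT//.
    rewrite (_ : [set t | _] = (fun t => k (psum Z c N t, Z 0%N t)) @^-1` [set 1]).
      by rewrite -[X in measurable X]setTI; exact: mXZ.
    apply/seteqP; split => t; rewrite /k/=; first by move=> ->.
    by case: (r < _) => //= /esym/eqP; rewrite oner_eq0.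
  by move=> t _; rewrite /= indicE mem_setE.
rewrite (integrate_out_psum hZ)//; last by left.
under eq_integral do rewrite /k/= normal_mean_tail integral_mkcond.
pose f (y : T * Rm) := ((density_fun y.2 (psum Z c N y.1))%:E *
  (r < y.2)%R%:R%:E)%E.
have mf : measurable_fun [set: T * Rm] f.
  apply: emeasurable_funM; first exact: mdens2.
  apply/measurable_EFinP; apply: measurable_natmul_bool.
  apply: measurable_fun_ltr => //; exact: (@measurable_snd _ _ T Rm).
have f0 y : (0 <= f y)%E by rewrite mule_ge0// lee_fin.
rewrite [RHS]integral_mkcond.
transitivity (\int[P]_t \int[mu]_s f (t, s))%E.
  apply: eq_integral => t _; apply: eq_integral => s _.
  by rewrite patchE mem_setE in_itv/= andbT /f/=; case: (r < s); rewrite ?mule1 ?mule0.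
rewrite (@fubini_tonelli _ _ T Rm R P mu f mf f0).
apply: eq_integral => s _; rewrite patchE mem_setE in_itv/= andbT /f/=.
case: (r < s); first by apply: eq_integral => t _; rewrite mule1.
by under eq_integral do rewrite mule0; rewrite integral0.
Qed.

End Density.

(** * Asymptotics of the density *)

Section DensityBounds.
Context d (T : measurableType d) (R : realType) (P : probability T R).
Variable Z : nat -> {RV P >-> R}.
Hypothesis hZ : iid_standard_normal Z.
Variables (alpha : R) (c : nat -> R).
Hypotheses (alpha_gt0 : 0 < alpha) (c_ge0 : forall i, 0 <= c i).
Implicit Types (x r s : R) (N : nat).

(** The loss due to the variance missing from the partial sum when the squares of all
    the coefficients add up to 1. *)
Definition damping N s : R :=
  expR (- (s ^+ 2 * (1 - alpha ^+ 2 - sqsum c N) / 2)).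

(** Completing the square: up to a factor free of [x], the density at [s] is the tilt
    by [s] itself times a bump centred at the mean [s * (1 - alpha^2)] of the tilted
    sum. This is the reason for the choice of the tilt. *)
Lemma density_fun_tilt N s x : density_fun alpha s x =
  2 / alpha * std_pdf s * damping N s *
  (tilt c s N x * (gauss_bump (alpha ^+ 2) (s * (1 - alpha ^+ 2)) x * nonneg_ind (s - x))).
Proof.
rewrite /density_fun !mulrA; congr (_ * _).
rewrite !std_pdfE /damping /tilt /gauss_bump.
have -> : 2 / alpha * (normal_peak 1 * expR (- (s ^+ 2 / 2))) *
    expR (- (s ^+ 2 * (1 - alpha ^+ 2 - sqsum c N) / 2)) *
    expR (s * x - s ^+ 2 * sqsum c N / 2) *
    expR (- ((x - s * (1 - alpha ^+ 2)) ^+ 2 / (2 * alpha ^+ 2))) =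
  2 / alpha * (normal_peak 1 * (expR (- (s ^+ 2 / 2)) *
    expR (- (s ^+ 2 * (1 - alpha ^+ 2 - sqsum c N) / 2)) *
    expR (s * x - s ^+ 2 * sqsum c N / 2) *
    expR (- ((x - s * (1 - alpha ^+ 2)) ^+ 2 / (2 * alpha ^+ 2))))) by ring.
rewrite -!expRD; congr (_ * (_ * expR _)).
by field; rewrite gt_eqF.
Qed.

Let sqrt_alpha2 : Num.sqrt (alpha ^+ 2) = alpha.
Proof. by rewrite sqrtr_sqr gtr0_norm. Qed.

Let alpha2_gt0 : 0 < alpha ^+ 2. Proof. exact: exprn_gt0. Qed.

Let scale N s : R := 2 / alpha * std_pdf s * damping N s.

Let scale_ge0 N s : 0 <= scale N s.
Proof. by rewrite !mulr_ge0 ?std_pdf_ge0 ?expR_ge0 ?invr_ge0// ltW. Qed.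

Lemma density_tilted_mean N s : density Z alpha c N s =
  ((scale N s)%:E * tilted_mean Z c s N
     (fun x => (gauss_bump (alpha ^+ 2) (s * (1 - alpha ^+ 2)) x * nonneg_ind (s - x))%R))%E.
Proof.
have mf : measurable_fun [set: R] (fun x =>
    gauss_bump (alpha ^+ 2) (s * (1 - alpha ^+ 2)) x * nonneg_ind (s - x)).
  apply: measurable_funM; first exact: measurable_gauss_bump.
  by apply: measurableT_comp (@measurable_nonneg_ind R) _; exact: measurable_funB.
rewrite /tilted_mean -ge0_integralZl//=.
- by apply: eq_integral => t _; rewrite (density_fun_tilt N) -EFinM.
- by apply/measurable_EFinP; exact: (measurable_psum_tilt Z c s N mf).
- by move=> t _; rewrite lee_fin !mulr_ge0 ?expR_ge0 ?nonneg_ind_ge0.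
- by rewrite lee_fin.
Qed.

(** Dropping the cut at [x <= s] and bounding by 1 both [damping] and the Gaussian
    factor of [bump_limit] can only increase the density. *)
Lemma density_upper N s : 0 <= s -> alpha ^+ 2 + sqsum c N <= 1 ->
  (density Z alpha c N s <= (2 * std_pdf s * (halfmass_prod c s N *
    ((Num.sqrt (alpha ^+ 2 + sqsum c N))^-1 + error_sum c s N / alpha ^+ 2)))%:E)%E.
Proof.
move=> s0 sg1; rewrite density_tilted_mean.
have [u _] := tilted_mean_gauss_bump hZ c_ge0 s0 N (s * (1 - alpha ^+ 2)) alpha2_gt0.
have mg := @measurable_gauss_bump R (alpha ^+ 2) (s * (1 - alpha ^+ 2)).
apply: (@le_trans _ _ ((scale N s)%:E * tilted_mean Z c s N
    (gauss_bump (alpha ^+ 2) (s * (1 - alpha ^+ 2))))%E).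
  apply: lee_wpmul2l; rewrite ?lee_fin//; apply: le_tilted_mean => //.
  - apply: measurable_funM => //.
    by apply: measurableT_comp (@measurable_nonneg_ind R) _; exact: measurable_funB.
  - by move=> x; rewrite mulr_ge0 ?gauss_bump_ge0 ?nonneg_ind_ge0.
  - by move=> x; rewrite ler_piMr ?gauss_bump_ge0 ?nonneg_ind_le1.
apply: le_trans (lee_wpmul2l _ u) _; first by rewrite lee_fin.
rewrite -EFinM lee_fin sqrt_alpha2.
have h0 := halfmass_prod_gt0 c_ge0 s0 N.
have e0 := error_sum_ge0 s c_ge0 N.
have sq0 : 0 < Num.sqrt (alpha ^+ 2 + sqsum c N).
  by rewrite sqrtr_gt0 ltr_wpDr ?sqsum_ge0.
apply: (@le_trans _ _ (2 / alpha * std_pdf s * (halfmass_prod c s N *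
    (alpha / Num.sqrt (alpha ^+ 2 + sqsum c N) + error_sum c s N / alpha)))).
  have b0 : 0 <= bump_limit c s N (alpha ^+ 2) (s * (1 - alpha ^+ 2)).
    by rewrite mulr_ge0 ?gauss_bump_ge0.
  apply: ler_pM.
  - exact: scale_ge0.
  - apply: mulr_ge0; first exact: ltW.
    by apply: addr_ge0 => //; apply: divr_ge0 => //; exact: ltW.
  - rewrite /scale ler_piMr//; first by rewrite !mulr_ge0 ?std_pdf_ge0 ?invr_ge0// ltW.
    rewrite /damping -[leRHS]expR0 ler_expR oppr_le0 mulr_ge0// mulr_ge0 ?sqr_ge0//.
    by rewrite -addrA -opprD subr_ge0.
  - apply: ler_wpM2l; first exact: ltW.
    rewrite lerD2r /bump_limit sqrtrM ?(ltW alpha2_gt0)// sqrt_alpha2 sqrtrV; last first.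
      by apply: addr_ge0; [exact: ltW|exact: sqsum_ge0].
    rewrite ler_piMr ?gauss_bump_le1//; first by rewrite divr_ge0// ltW.
    by rewrite ltr_wpDr ?sqsum_ge0.
rewrite le_eqVlt; apply/orP; left; apply/eqP; field.
by rewrite !gt_eqF.
Qed.

(** The last term pays for restoring the cut at [x <= s]: the bump is tiny beyond [s]. *)
Lemma density_lower N s : 0 <= s ->
  ((2 * std_pdf s * damping N s * (halfmass_prod c s N *
     (bump_limit c s N (alpha ^+ 2) (s * (1 - alpha ^+ 2)) / alpha
      - error_sum c s N / alpha ^+ 2
      - expR (- (s ^+ 2 * alpha ^+ 2 / 2)) / alpha)))%:E
   <= density Z alpha c N s)%E.
Proof.
move=> s0; rewrite density_tilted_mean.
have [_ l] := tilted_mean_gauss_bump hZ c_ge0 s0 N (s * (1 - alpha ^+ 2)) alpha2_gt0.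
have mg := @measurable_gauss_bump R (alpha ^+ 2) (s * (1 - alpha ^+ 2)).
set b := bump_limit c s N _ _; set q := expR _; set h := halfmass_prod c s N.
set e := error_sum c s N.
set W := tilted_mean _ _ _ _ _.
have mi : measurable_fun [set: R] (fun x => nonneg_ind (s - x)).
  by apply: measurableT_comp (@measurable_nonneg_ind R) _; exact: measurable_funB.
have mgi : measurable_fun [set: R] (fun x =>
    gauss_bump (alpha ^+ 2) (s * (1 - alpha ^+ 2)) x * nonneg_ind (s - x)).
  exact: measurable_funM.
(* Beyond [s] the bump is at most [q], since its centre lies [s * alpha^2] below. *)
have cut : (tilted_mean Z c s N (gauss_bump (alpha ^+ 2) (s * (1 - alpha ^+ 2))) <=
    W + (q * h)%:E)%E.
  have -> : (W + (q * h)%:E)%E = tilted_mean Z c s N (fun x => 1 *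
      (gauss_bump (alpha ^+ 2) (s * (1 - alpha ^+ 2)) x * nonneg_ind (s - x)) + q).
    rewrite tilted_mean_affine ?mul1e ?tilted_mean1 ?EFinM ?expR_ge0//.
    by move=> x; rewrite mulr_ge0 ?gauss_bump_ge0 ?nonneg_ind_ge0.
  apply: le_tilted_mean => //.
  - by apply: measurable_funD => //; exact: measurable_funM.
  - by move=> x; exact: gauss_bump_ge0.
  move=> x; rewrite mul1r nonneg_indE; have [sx|xs] := leP 0 (s - x).
    by rewrite mulr1 lerDl expR_ge0.
  rewrite mulr0 add0r /q /gauss_bump ler_expR lerN2.
  have -> : s ^+ 2 * alpha ^+ 2 / 2 = (s * alpha ^+ 2) ^+ 2 / (2 * alpha ^+ 2).
    by field; rewrite gt_eqF.
  rewrite ler_pM2r ?invr_gt0 ?mulr_gt0// lerXn2r ?nnegrE//.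
  - by rewrite mulr_ge0// ltW.
  - by have := mulr_ge0 s0 (ltW alpha2_gt0); lra.
  - by lra.
have h0 : 0 < h := halfmass_prod_gt0 c_ge0 s0 N.
have key : ((h * (b - e / alpha - q))%:E <= W)%E.
  rewrite -(leeD2rE _ _ (_ : (h * (e / alpha) + q * h)%:E \is a fin_num))//.
  rewrite -EFinD (_ : h * (b - e / alpha - q) + _ = h * b); last by ring.
  apply: le_trans l _; rewrite sqrt_alpha2 -/h -/e.
  by rewrite (addrC (h * _)) EFinD addeA leeD2r.
apply: le_trans (lee_wpmul2l (_ : (0 <= (scale N s)%:E)%E) key); last by rewrite lee_fin.
rewrite -EFinM lee_fin /scale le_eqVlt; apply/orP; left; apply/eqP; field.
by rewrite gt_eqF.
Qed.

End DensityBounds.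

(** * Vanishing of the replacement errors *)

Section ErrorSum.
Context {R : realType}.
Variable c : nat -> R.
Hypotheses (c_ge0 : forall i, 0 <= c i) (c_sum : cvgn (series c)).

(** Each term of the error sum is at most a multiple of both [c i] and [1 / s]:
    the first bound controls the tail, the second one the remaining terms. *)
Lemma error_sum_vanishes (eta : R) : 0 < eta ->
  exists2 s0, 0 < s0 & forall s N, s0 <= s -> error_sum c s N <= eta.
Proof.
move=> eta0; have [C C0 hC] := @step_error_bounded R.
have ndc : nondecreasing_seq (series c) by apply/nondecreasing_series => i _ _.
have C40 : 0 < eta / (4 * C) by rewrite divr_gt0// mulr_gt0.
have [M hM] : exists M, forall k, series c (k + M) - series c M <= eta / (4 * C).
  have /cvgrPdist_lt /(_ _ C40) [M _ hM] := c_sum.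
  exists M => k; have := hM M (leqnn M).
  have := nondecreasing_cvgn_le ndc c_sum (k + M)%N.
  by rewrite distrC => h1 /ltr_distlCDr; lra.
exists (4 * C * M.+1%:R / eta) => [|s N hs].
  by rewrite divr_gt0// !mulr_gt0.
have s0 : 0 < s.
  by apply: lt_le_trans hs; rewrite divr_gt0// !mulr_gt0.
have term i : 2 * (c i * step_error (s * c i)) <= 2 * C * c i /\
    2 * (c i * step_error (s * c i)) <= 2 * C / s.
  have [h1 h2] := hC (s * c i) (mulr_ge0 (ltW s0) (c_ge0 i)).
  split; first by rewrite -mulrA ler_pM2l// mulrC ler_wpM2r.
  rewrite -mulrA ler_pM2l// ler_pdivlMr//.
  by rewrite mulrC mulrA.
have mono N' k : error_sum c s N' <= error_sum c s (k + N').
  elim: k => // k IH; rewrite addSn error_sumS (le_trans IH)// lerDl.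
  by rewrite !mulr_ge0// step_error_ge0.
have head : error_sum c s M <= M%:R * (2 * C / s).
  elim: (M) => [|k IH]; first by rewrite /error_sum big_ord0 mul0r.
  have -> : k.+1%:R * (2 * C / s) = k%:R * (2 * C / s) + 2 * C / s.
    by rewrite -natr1; ring.
  by rewrite error_sumS; apply: lerD => //; exact: (term k).2.
have tail k : error_sum c s (k + M) <=
    error_sum c s M + 2 * C * (series c (k + M) - series c M).
  elim: k => [|k IH]; first by rewrite subrr mulr0 addr0.
  rewrite addSn error_sumS seriesSr.
  by have := (term (k + M)%N).1; lra.
apply: le_trans (mono N M) _; rewrite addnC; apply: le_trans (tail N) _.
have h1 : M%:R * (2 * C / s) <= eta / 2.
  rewrite mulrA ler_pdivrMr// mulrC; move: hs; rewrite ler_pdivrMr// => hs.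
  have : 4 * C * M%:R <= 4 * C * M.+1%:R :> R by rewrite ler_pM2l ?mulr_gt0// ler_nat.
  lra.
have h2 : 2 * C * (series c (N + M) - series c M) <= eta / 2.
  have := hM N; rewrite -(ler_pM2l (_ : 0 < 2 * C)) ?mulr_gt0//.
  have -> : 2 * C * (eta / (4 * C)) = eta / 2 by field; rewrite gt_eqF.
  by [].
lra.
Qed.

End ErrorSum.

(** * Summation by parts against sequences of bounded variation *)

Section Abel.
Context {R : realType}.
Implicit Types (w t : nat -> R) (n : nat).

Definition variation w n : R := \sum_(i < n) `|w i.+1 - w i|.

Lemma abel_bound w t B V delta n : 0 <= delta ->
  (forall i, `|w i| <= B) -> variation w n <= V ->
  (forall k, `|\sum_(i < k) t i| <= delta) ->
  `|\sum_(i < n) w i * t i| <= (B + V) * delta.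
Proof.
move=> d0 wB wV tD.
(* Summation by parts moves the differences from the partial sums [S] to [w]. *)
pose S k := \sum_(i < k) t i.
have -> : \sum_(i < n) w i * t i = w n * S n + \sum_(i < n) (w i - w i.+1) * S i.+1.
  elim: (n) => [|k IH]; first by rewrite /S !big_ord0 mulr0 addr0.
  by rewrite big_ord_recr [in RHS]big_ord_recr/= IH /S big_ord_recr /=; ring.
rewrite mulrDl (le_trans (ler_normD _ _))// lerD//.
  by rewrite normrM; apply: ler_pM => //; exact: tD.
apply: le_trans (ler_wpM2r d0 wV).
rewrite (le_trans (ler_norm_sum _ _ _))// /variation mulr_suml ler_sum// => i _.
by rewrite normrM distrC ler_wpM2l//; exact: tD.
Qed.

Lemma variation_le_mono w B n : (forall i, 0 <= w i <= B) ->
  (nondecreasing_seq w \/ nonincreasing_seq w) -> variation w n <= B.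
Proof.
move=> wB; case=> mw.
- suff -> : variation w n = w n - w 0%N.
    by have /andP[_] := wB n; have /andP[] := wB 0%N; lra.
  elim: n => [|k IH]; first by rewrite /variation big_ord0 subrr.
  rewrite /variation big_ord_recr/= -/(variation w k) IH ger0_norm; first by ring.
  by rewrite subr_ge0; exact: mw.
- suff -> : variation w n = w 0%N - w n.
    by have /andP[+ _] := wB n; have /andP[] := wB 0%N; lra.
  elim: n => [|k IH]; first by rewrite /variation big_ord0 subrr.
  rewrite /variation big_ord_recr/= -/(variation w k) IH ler0_norm; first by ring.
  by rewrite subr_le0; exact: mw.
Qed.

Lemma variationD w1 w2 n :
  variation (fun i => w1 i + w2 i) n <= variation w1 n + variation w2 n.
Proof.
rewrite /variation -big_split ler_sum// => i _ /=.
rewrite (_ : _ - _ = (w1 i.+1 - w1 i) + (w2 i.+1 - w2 i)); last by ring.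
exact: ler_normD.
Qed.

Lemma variationM w1 w2 B1 B2 n : 0 <= B1 -> 0 <= B2 ->
  (forall i, `|w1 i| <= B1) -> (forall i, `|w2 i| <= B2) ->
  variation (fun i => w1 i * w2 i) n <= B2 * variation w1 n + B1 * variation w2 n.
Proof.
move=> B10 B20 h1 h2; rewrite /variation !mulr_sumr -big_split ler_sum// => i _ /=.
rewrite (_ : _ - _ = w2 i.+1 * (w1 i.+1 - w1 i) + w1 i * (w2 i.+1 - w2 i)); last by ring.
by rewrite (le_trans (ler_normD _ _))// !normrM lerD// ler_wpM2r.
Qed.

End Abel.

Section HazardWeight.
Context {R : realType}.
Implicit Types (x y : R).

Definition peak_fun x : R := x * expR (- (x ^+ 2 / 2)).

Lemma peak_fun_ge0 x : 0 <= x -> 0 <= peak_fun x.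
Proof. by move=> x0; rewrite mulr_ge0 ?expR_ge0. Qed.

Lemma peak_fun_le1 x : peak_fun x <= 1.
Proof.
rewrite /peak_fun expRN ler_pdivrMr ?expR_gt0// mul1r.
apply: le_trans (expR_ge1Dx _); have := sqr_ge0 (x - 1); nra.
Qed.

Lemma peak_fun_incr x y : 0 <= x -> x <= y -> y <= 1 -> peak_fun x <= peak_fun y.
Proof.
move=> x0 xy y1; rewrite /peak_fun.
have -> : - (y ^+ 2 / 2) = - (x ^+ 2 / 2) - (y - x) * (y + x) / 2 by field.
rewrite expRD mulrCA [leLHS]mulrC ler_wpM2l ?expR_ge0//.
have y0 : 0 <= y by exact: le_trans xy.
apply: le_trans (ler_wpM2l y0 (expR_ge1Dx _)).
have h : y * (y + x) / 2 <= 1 by nra.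
have : (y - x) * (y * (y + x) / 2) <= (y - x) * 1 by rewrite ler_wpM2l// subr_ge0.
lra.
Qed.

Lemma peak_fun_decr x y : 1 <= x -> x <= y -> peak_fun y <= peak_fun x.
Proof.
move=> x1 xy; rewrite /peak_fun.
have -> : - (x ^+ 2 / 2) = - (y ^+ 2 / 2) + (y - x) * (y + x) / 2 by field.
rewrite expRD mulrCA [leLHS]mulrC ler_wpM2l ?expR_ge0//.
have x0 : 0 <= x by lra.
apply: le_trans (ler_wpM2l x0 (expR_ge1Dx _)).
have h : 1 <= x * (y + x) / 2 by nra.
have : (y - x) * 1 <= (y - x) * (x * (y + x) / 2) by rewrite ler_wpM2l// subr_ge0.
lra.
Qed.

(** Along a monotone sequence the unimodal function [peak_fun] first rises and
    then falls; cutting the sequence at the mode [1] splits it into two monotone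
    sequences. *)
Lemma variation_peak_fun (z : nat -> R) n : (forall i, 0 <= z i) ->
  nonincreasing_seq z -> variation (fun i => peak_fun (z i)) n <= 2.
Proof.
move=> z0 dz.
pose w1 i := peak_fun (Num.min (z i) 1).
(* The constant 1 only makes the second sequence nonnegative. *)
pose w2 i := 1 + (peak_fun (Num.max (z i) 1) - peak_fun 1).
have min01 i : 0 <= Num.min (z i) 1 <= 1.
  by rewrite le_min z0 ler01 ge_min lexx orbT.
have max1 i : 1 <= Num.max (z i) 1 by rewrite le_max lexx orbT.
have -> : variation (fun i => peak_fun (z i)) n = variation (fun i => w1 i + w2 i) n.
  have E i : w1 i + w2 i = peak_fun (z i) + 1.
    rewrite /w1 /w2; have [h|h] := leP (z i) 1; ring.
  by apply: eq_bigr => i _; rewrite !E; congr (`|_|); ring.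
apply: le_trans (variationD _ _ _) _.
rewrite (_ : 2 = 1 + 1 :> R)// lerD//; apply: variation_le_mono.
- by move=> i; rewrite peak_fun_le1 peak_fun_ge0//; have /andP[] := min01 i.
- right=> i j ij; apply: peak_fun_incr.
  + by have /andP[] := min01 j.
  + by rewrite le_min ge_min (dz _ _ ij) /= ge_min lexx orbT.
  + by have /andP[] := min01 i.
- move=> i; have := peak_fun_le1 1; have := peak_fun_decr (lexx 1) (max1 i).
  have := peak_fun_ge0 (le_trans ler01 (max1 i)); rewrite /w2; lra.
- left=> i j ij; rewrite /w2 lerD2l lerD2r; apply: peak_fun_decr => //.
  by rewrite ge_max le_max (dz _ _ ij) /= le_max lexx orbT.
Qed.

(** The derivative of [ln (halfmass x)] with respect to [ln x]. *)
Definition hazard x : R := x * std_pdf x / halfmass x.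

Lemma hazardE x :
  hazard x = normal_peak 1 * (peak_fun x * (halfmass x)^-1).
Proof. by rewrite /hazard std_pdfE /peak_fun; ring. Qed.

(** [hazard] is the product of a unimodal function and of a decreasing one, so its
    variation along a monotone sequence is bounded whatever the scale of the
    sequence. *)
Lemma hazard_bounded_variation : exists2 C : R, 0 < C &
  forall (z : nat -> R) n, (forall i, 0 <= z i) -> nonincreasing_seq z ->
  (forall i, `|hazard (z i)| <= C) /\ variation (fun i => hazard (z i)) n <= C.
Proof.
pose K : R := normal_peak 1.
have K0 : 0 < K by rewrite normal_peak_gt0// oner_eq0.
exists (6 * K) => [|z n z0 dz]; first by rewrite mulr_gt0.
have inv2 i : 0 <= (halfmass (z i))^-1 <= 2.
  rewrite invr_ge0 halfmass_ge0/= invf_ple ?posrE ?halfmass_gt0//.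
  exact: halfmass_ge_half.
have p01 i : 0 <= peak_fun (z i) <= 1 by rewrite peak_fun_ge0// peak_fun_le1.
have E i : hazard (z i) = K * (peak_fun (z i) * (halfmass (z i))^-1).
  exact: hazardE.
split.
  move=> i; have /andP[h1 h2] := inv2 i; have /andP[h3 h4] := p01 i.
  rewrite E normrM (gtr0_norm K0) mulrC ler_pM2r// ger0_norm ?mulr_ge0//.
  by apply: le_trans (ler_pM h3 h1 h4 h2) _; lra.
have -> : variation (fun i => hazard (z i)) n =
    K * variation (fun i => peak_fun (z i) * (halfmass (z i))^-1) n.
  rewrite /variation mulr_sumr; apply: eq_bigr => i _.
  by rewrite !E -mulrBr normrM (gtr0_norm K0).
rewrite mulrC ler_pM2r//.
apply: le_trans (@variationM _ _ _ 1 2 _ _ _ _ _) _ => //.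
- by move=> i; have /andP[h1 h2] := p01 i; rewrite ger0_norm.
- by move=> i; have /andP[h1 h2] := inv2 i; rewrite ger0_norm.
have v1 := variation_peak_fun n z0 dz.
have : variation (fun i => (halfmass (z i))^-1) n <= 2.
  apply: variation_le_mono => //; left=> i j ij.
  by rewrite lef_pV2 ?posrE ?halfmass_gt0// halfmass_mono// dz.
by lra.
Qed.

End HazardWeight.

(** * Comparison of products of half line masses *)

Section ProductComparison.
Context {R : realType}.
Implicit Types (A B u : nat -> R) (x y s : R).

(** A quotient of two partial products tends to 1, so its logarithm tends to 0; the
    factors themselves are quotients of consecutive partial products, hence positive
    past some rank. *)
Lemma prod_converges_tails u : prod_converges u -> forall delta, 0 < delta ->
  exists M0, forall M, (M0 <= M)%N ->
    (forall i, 0 < u (M + i)%N) /\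
    (forall k, `|\sum_(i < k) ln (u (M + i)%N)| <= delta).
Proof.
move=> [N [l l0 ul]] delta delta0.
pose p n := \prod_(N <= i < n) u i.
have pl : p n / l @[n --> \oo] --> (1 : R).
  rewrite -(divff l0); apply: cvgM => //; exact: cvg_cst.
have lnpl : ln (p n / l) @[n --> \oo] --> (0 : R).
  rewrite -ln1; apply: (continuous_cvg _ _ pl).
  exact: continuous_ln.
have d2 : 0 < delta / 2 by rewrite divr_gt0.
have h1 : \forall n \near \oo, 0 < p n / l by exact: (cvgr_gt _ pl).
have h2 : \forall n \near \oo, `|ln (p n / l)| < delta / 2.
  have /cvgrPdist_lt /(_ _ d2) := lnpl.
  by apply: filterS => n; rewrite sub0r normrN.
have [M1 _ hM] : \forall n \near \oo, 0 < p n / l /\ `|ln (p n / l)| < delta / 2.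
  by apply: filterI.
exists (maxn N M1) => M; rewrite geq_max => /andP[NM M1M].
have H k := hM (M + k)%N (leq_trans M1M (leq_addr k M)).
have pS k : p (M + k.+1)%N = p (M + k)%N * u (M + k)%N.
  by rewrite /p addnS big_nat_recr//= (leq_trans NM)// leq_addr.
have p0 k : p (M + k)%N != 0.
  have := (H k).1; rewrite lt0r => /andP[+ _].
  by apply: contra => /eqP ->; rewrite mul0r.
have uE k : u (M + k)%N = (p (M + k.+1)%N / l) / (p (M + k)%N / l).
  by rewrite pS; field; rewrite l0 p0.
have lnu k : ln (u (M + k)%N) = ln (p (M + k.+1)%N / l) - ln (p (M + k)%N / l).
  by rewrite uE ln_div// posrE; [exact: (H k.+1).1|exact: (H k).1].
have u0 k : 0 < u (M + k)%N.
  by rewrite uE divr_gt0//; [exact: (H k.+1).1|exact: (H k).1].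
split=> // k.
have -> : \sum_(i < k) ln (u (M + i)%N) = ln (p (M + k)%N / l) - ln (p (M + 0)%N / l).
  elim: k => [|k IH]; first by rewrite big_ord0 subrr.
  by rewrite big_ord_recr/= IH lnu; ring.
apply: le_trans (ler_normB _ _) _.
by have := (H k).2; have := (H 0%N).2; lra.
Qed.

(** Concavity bounds the relative increment of the mass by [hazard x * (rho - 1)]
    with [rho = y / x], and [rho - 1 <= - ln (2 - rho)] makes the factor of the
    product appear. *)
Lemma halfmass_ratio x y : 0 < x -> 0 <= y -> 0 < 2 - y / x ->
  halfmass y <= halfmass x * expR (hazard x * - ln (2 - y / x)).
Proof.
move=> x0 y0 u0.
have p0 := @halfmass_gt0 R x (ltW x0).
have w0 : 0 <= hazard x.
  by rewrite /hazard !mulr_ge0 ?std_pdf_ge0 ?invr_ge0// ltW.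
apply: le_trans (halfmass_tangent (ltW x0) y0) _.
have -> : halfmass x + std_pdf x * (y - x) = halfmass x * (1 + hazard x * (y / x - 1)).
  by rewrite /hazard; field; rewrite !gt_eqF.
rewrite ler_pM2l//; apply: le_trans (expR_ge1Dx _) _.
rewrite ler_expR ler_wpM2l//.
have : ln (1 + (1 - y / x)) <= 1 - y / x by apply: le_ln1Dx; lra.
by rewrite (_ : 1 + (1 - y / x) = 2 - y / x); [lra|ring].
Qed.

(** For a fixed number of factors each mass tends to 1 as [s] grows. *)
Lemma halfmass_prod_head A B (M : nat) (eps : R) : 0 < eps ->
  (forall i, 0 < B i) ->
  exists2 s0 : R, 0 < s0 & forall s N, s0 <= s -> (N <= M)%N ->
    halfmass_prod A s N <= expR eps * halfmass_prod B s N.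
Proof.
move=> eps0 B0; elim: M eps eps0 => [|M IH] eps eps0.
  exists 1 => // s N _; rewrite leqn0 => /eqP ->.
  by rewrite /halfmass_prod !big_ord0 mulr1 ltW// expR_gt1.
have e2 : 0 < eps / 2 by rewrite divr_gt0.
have [s1 s10 h1] := IH _ e2.
have [C C0 hC] := @halfmassC_bounded R.
have q0 : 0 < 1 - expR (- (eps / 2)) by rewrite subr_gt0 expR_lt1 oppr_lt0.
pose s2 := C / (B M * (1 - expR (- (eps / 2)))).
have s20 : 0 < s2 by rewrite divr_gt0// mulr_gt0.
exists (s1 + s2) => [|s N hs]; first by rewrite addr_gt0.
have s0 : 0 < s by apply: lt_le_trans hs; rewrite addr_gt0.
have ss1 : s1 <= s by lra.
have ss2 : s2 <= s by lra.
have hp K : 0 <= halfmass_prod B s K.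
  by apply: prodr_ge0 => i _; rewrite mulr_ge0// halfmass_ge0.
have hpA K : 0 <= halfmass_prod A s K.
  by apply: prodr_ge0 => i _; rewrite mulr_ge0// halfmass_ge0.
rewrite leq_eqVlt => /predU1P[->|]; last first.
  rewrite ltnS => NM; apply: le_trans (h1 s N ss1 NM) _.
  by rewrite ler_wpM2r// ler_expR; lra.
rewrite !halfmass_prodS.
have step : 1 <= expR (eps / 2) * halfmass (s * B M).
  rewrite -ler_pdivrMl ?expR_gt0// mulr1 -expRN.
  have sB : 0 < s * B M by rewrite mulr_gt0.
  have := hC (s * B M) (ltW sB).
  have : C <= s * B M * (1 - expR (- (eps / 2))).
    by move: ss2; rewrite /s2 ler_pdivrMr ?mulr_gt0// mulrA.
  move=> h h'; have := le_trans h' h; rewrite ler_pM2l//; lra.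
have := h1 s M ss1 (leqnn M).
have pA1 := @halfmass_le1 R (s * A M).
move=> h; apply: (@le_trans _ _ (expR (eps / 2) * halfmass_prod B s M *
    (2 * (expR (eps / 2) * halfmass (s * B M))))).
  apply: ler_pM => //; first by rewrite mulr_ge0 ?halfmass_ge0.
  by rewrite ler_pM2l// (le_trans pA1).
rewrite le_eqVlt; apply/orP; left; apply/eqP.
have -> : expR eps = expR (eps / 2) * expR (eps / 2) by rewrite -expRD -splitr.
by ring.
Qed.

Lemma halfmass_prodD A s M k : halfmass_prod A s (M + k) =
  halfmass_prod A s M * halfmass_prod (fun i => A (M + i)%N) s k.
Proof.
elim: k => [|k IH]; first by rewrite addn0 /halfmass_prod big_ord0 mulr1.
by rewrite addnS !halfmass_prodS IH [RHS]mulrA.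
Qed.

(** Beyond some rank the logarithm of the ratio is at most the sum of the [- ln] of
    the factors [2 - A i / B i] weighted by [hazard (s * B i)]. As these weights have
    bounded variation uniformly in [s], the convergence of the product makes that sum
    small even when it converges only conditionally. *)
Lemma halfmass_prod_compare A B (eps : R) : 0 < eps ->
  (forall i, 0 < A i) -> (forall i, 0 < B i) -> nonincreasing_seq B ->
  prod_converges (fun n => 2 - A n / B n) ->
  exists2 s0 : R, 0 < s0 & forall s N, s0 <= s ->
    halfmass_prod (fun i => A i.+1) s N <=
    expR eps * halfmass_prod (fun i => B i.+1) s N.
Proof.
move=> eps0 A0 B0 dB hprod.
have [C C0 hC] := @hazard_bounded_variation R.
have e2 : 0 < eps / 2 by rewrite divr_gt0.
have delta0 : 0 < eps / 2 / (C + C) by rewrite divr_gt0// addr_gt0.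
have [M0 hM0] := prod_converges_tails hprod delta0.
have [u0 ulog] := hM0 M0.+1 (leqnSn M0).
have [s0 s00 hs0] := @halfmass_prod_head (fun i => A i.+1) (fun i => B i.+1) M0 _ e2
  (fun i => B0 i.+1).
exists s0 => // s N ss0; have s_gt0 : 0 < s by exact: lt_le_trans ss0.
have hpos (F : nat -> R) K : 0 <= halfmass_prod F s K.
  by apply: prodr_ge0 => i _; rewrite mulr_ge0// halfmass_ge0.
have [NM|/ltnW MN] := leqP N M0.
  apply: le_trans (hs0 s N ss0 NM) _.
  by rewrite ler_wpM2r// ler_expR; lra.
rewrite -(subnKC MN); move: (N - M0)%N => k {MN}.
rewrite !halfmass_prodD.
have -> : expR eps = expR (eps / 2) * expR (eps / 2) by rewrite -expRD -splitr.
rewrite mulrACA; apply: ler_pM => //; first exact: hs0.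
pose z i := s * B (M0.+1 + i)%N.
have z0 i : 0 < z i by rewrite mulr_gt0.
have dz : nonincreasing_seq z.
  by move=> i j ij; rewrite ler_pM2l//; apply: dB; rewrite leq_add2l.
pose t i := - ln (2 - A (M0.+1 + i)%N / B (M0.+1 + i)%N).
apply: (@le_trans _ _ (\prod_(i < k)
    (expR (hazard (z i) * t i) * (2 * halfmass (z i))))).
  apply: ler_prod => i _; rewrite mulr_ge0 ?halfmass_ge0//=.
  rewrite mulrCA ler_pM2l// [leRHS]mulrC.
  have -> : t i = - ln (2 - s * A (M0.+1 + i)%N / z i).
    by rewrite /t /z -mulf_div divff ?mul1r// gt_eqF.
  apply: halfmass_ratio => //; first by rewrite ltW// mulr_gt0.
  by rewrite /z -mulf_div divff ?mul1r ?u0// gt_eqF.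
rewrite big_split/= ler_wpM2r//; first exact: (hpos (fun i => B (M0.+1 + i)%N)).
rewrite -expR_sum ler_expR.
have [hz1 hz2] := hC z k (fun i => ltW (z0 i)) dz.
have := abel_bound (ltW delta0) hz1 hz2 (t := t).
have -> : (C + C) * (eps / 2 / (C + C)) = eps / 2.
  by rewrite mulrC divfK// gt_eqF// addr_gt0.
move=> h.
apply: le_trans (ler_norm _) (h _) => j.
by rewrite /t sumrN normrN.
Qed.

End ProductComparison.

(** * Tail events of the infinite sum *)

Section LiminfBounds.
Context {R : realType}.
Implicit Types (u : nat -> \bar R) (x : \bar R).

Lemma limn_einf_ge u x : (\forall n \near \oo, x <= u n)%E -> (x <= limn_einf u)%E.
Proof.
move=> [N _ hN]; rewrite limn_einf_lim.
apply: lime_ge; first exact: is_cvg_einfs.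
exists N => // n /= Nn; apply: le_ereal_inf_tmp => _ [k /= nk <-].
by apply: hN; exact: leq_trans nk.
Qed.

Lemma limn_einf_le u x : (forall n, (u n <= x)%E) -> (limn_einf u <= x)%E.
Proof.
move=> ux; rewrite limn_einf_lim.
apply: lime_le; first exact: is_cvg_einfs.
apply: nearW => n; apply: le_trans (ux n).
by apply: ereal_inf_lbound; exists n => /=.
Qed.

End LiminfBounds.

Section StrictTail.
Context d (T : measurableType d) (R : realType) (P : probability T R).
Variable Z : nat -> {RV P >-> R}.
Variable A : nat -> R.
Hypothesis A_gt0 : forall n, 0 < A n.

Definition initial_sum N t : R := A 0%N * `|Z 0%N t| + psum Z (fun i => A i.+1) N t.

Lemma measurable_initial_sum N : measurable_fun [set: T] (initial_sum N).
Proof.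
apply: measurable_funD; last exact: measurable_psum.
by apply: measurable_funM => //; exact: measurableT_comp.
Qed.

Lemma initial_sumE N t :
  (\sum_(0 <= n < N.+1) (A n * `|Z n t|)%:E)%E = (initial_sum N t)%:E.
Proof.
rewrite sumEFin; congr (_%:E).
by rewrite big_nat_recl//= /initial_sum /psum big_mkord.
Qed.

Let term_ge0 n t : (0 <= (A n * `|Z n t|)%:E)%E.
Proof. by rewrite lee_fin mulr_ge0// ltW. Qed.

Lemma initial_sum_le N t : ((initial_sum N t)%:E <= weighted_abs_sum Z A t)%E.
Proof. by rewrite -initial_sumE; apply: nneseries_lim_ge => n _ _. Qed.

Lemma initial_sum_mono t : nondecreasing_seq (initial_sum ^~ t).
Proof.
apply/nondecreasing_seqP => N; rewrite /initial_sum psumS addrA lerDl.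
by rewrite mulr_ge0// ltW.
Qed.

Lemma strict_tailE (r : R) :
  [set t | (r%:E < weighted_abs_sum Z A t)%E] =
  \bigcup_N [set t | r < initial_sum N t].
Proof.
apply/seteqP; split => t /=; last first.
  by move=> [N _ /= h]; apply: lt_le_trans (initial_sum_le N t); rewrite lte_fin.
rewrite ltNge => h; apply: contrapT => hN; move/negP: h; apply.
rewrite /weighted_abs_sum; apply: lime_le.
  by apply: is_cvg_nneseries => n _ _; exact: term_ge0.
exists 1%N => // -[//|N] _ /=; rewrite initial_sumE lee_fin leNgt.
by apply/negP => rN; apply: hN; exists N.
Qed.

Lemma measurable_strict_partial (r : R) N :
  measurable [set t | r < initial_sum N t].
Proof.
rewrite (_ : [set t | _] = initial_sum N @^-1` `]r, +oo[).
  by rewrite -[X in measurable X]setTI; exact: measurable_initial_sum.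
by apply/seteqP; split => t /=; rewrite in_itv/= andbT.
Qed.

(** With a strict inequality the event is the increasing union of the corresponding
    events for the partial sums, which fails with a non-strict one. *)
Definition strict_tail (r : R) : \bar R :=
  P [set t | (r%:E < weighted_abs_sum Z A t)%E].

Lemma measurable_strict_tail (r : R) :
  measurable [set t | (r%:E < weighted_abs_sum Z A t)%E].
Proof.
by rewrite strict_tailE; apply: bigcup_measurable => N _; exact: measurable_strict_partial.
Qed.

Lemma strict_tail_ge (r : R) N :
  (P [set t | (r < initial_sum N t)%R] <= strict_tail r)%E.
Proof.
apply: le_measure; rewrite ?inE.
- exact: measurable_strict_partial.
- exact: measurable_strict_tail.
- by rewrite strict_tailE => t /= h; exists N.
Qed.

Lemma strict_tail_le (r : R) (x : \bar R) :
  (\forall N \near \oo, P [set t | (r < initial_sum N t)%R] <= x)%E ->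
  (strict_tail r <= x)%E.
Proof.
move=> h; rewrite /strict_tail strict_tailE.
apply: (cvge_le h); apply: nondecreasing_cvg_mu.
- by move=> N; exact: measurable_strict_partial.
- by apply: bigcup_measurable => N _; exact: measurable_strict_partial.
- move=> M N MN; apply/subsetPset => t /= /lt_le_trans; apply.
  exact: initial_sum_mono.
Qed.

Lemma tail_capE (r : R) :
  [set t | (r%:E <= weighted_abs_sum Z A t)%E] =
  \bigcap_k [set t | ((r - k.+1%:R^-1)%:E < weighted_abs_sum Z A t)%E].
Proof.
apply/seteqP; split => t /=.
  move=> h k _ /=; apply: lt_le_trans h.
  by rewrite lte_fin ltrBlDr ltrDl invr_gt0.
move=> h; have := h 0%N I => /=; case E : (weighted_abs_sum Z A t) => [y| |] //= _; last exact: leey.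
rewrite lee_fin; apply/ler_addgt0Pr => e e0.
have [k hk] : exists k, k.+1%:R^-1 < e :> R.
  exists (Num.truncn e^-1); rewrite invf_plt ?posrE//; exact: Num.Theory.truncnS_gt.
have := h k I; rewrite /= E lte_fin ltrBlDr => /ltW h'.
by apply: le_trans h' _; rewrite lerD2l ltW.
Qed.

Lemma measurable_tail (r : R) :
  measurable [set t | (r%:E <= weighted_abs_sum Z A t)%E].
Proof.
by rewrite tail_capE; apply: bigcap_measurable => // k _; exact: measurable_strict_tail.
Qed.

Lemma strict_tail_cvg (r : R) :
  strict_tail (r - k.+1%:R^-1) @[k --> \oo] -->
  P [set t | (r%:E <= weighted_abs_sum Z A t)%E].
Proof.
rewrite tail_capE; apply: nonincreasing_cvg_mu.
- by rewrite -ge0_fin_numE// fin_num_measure//; exact: measurable_strict_tail.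
- by move=> k; exact: measurable_strict_tail.
- by rewrite -tail_capE; exact: measurable_tail.
- move=> k l kl; apply/subsetPset => t /=; apply: le_lt_trans.
  by rewrite lee_fin lerD2l lerN2 lef_pV2 ?posrE// ler_nat.
Qed.

End StrictTail.

(** * Density estimates for normalized coefficients *)

Section NormalizedTail.
Context d (T : measurableType d) (R : realType) (P : probability T R).
Variable Z : nat -> {RV P >-> R}.
Hypothesis hZ : iid_standard_normal Z.
Variable A : nat -> R.
Hypotheses (A_gt0 : forall n, 0 < A n) (A_sum : cvgn (series A))
  (A_sq : series (fun n => A n ^+ 2) @ \oo --> (1 : R)).
Local Notation c := (fun i => A i.+1).

Let c_ge0 i : 0 <= c i. Proof. exact: ltW. Qed.

Lemma sqsum_series N : A 0%N ^+ 2 + sqsum c N = series (fun n => A n ^+ 2) N.+1.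
Proof. by rewrite /series/= big_nat_recl//= /sqsum big_mkord. Qed.

Lemma sqsum_le1 N : A 0%N ^+ 2 + sqsum c N <= 1.
Proof.
rewrite sqsum_series -(cvg_lim (@Rhausdorff R) A_sq).
apply: nondecreasing_cvgn_le; last by apply/cvg_ex; exists 1.
by apply/nondecreasing_series => n _ _; exact: sqr_ge0.
Qed.

Lemma sqsum_cvg : A 0%N ^+ 2 + sqsum c N @[N --> \oo] --> (1 : R).
Proof.
rewrite (_ : (fun N => _) =
    [sequence series (fun n => A n ^+ 2) N.+1]_N); first by rewrite cvg_shiftS.
by apply/funext => N; exact: sqsum_series.
Qed.

Let tail_sum : cvgn (series c).
Proof.
rewrite (_ : series c = fun n => series A n.+1 - A 0%N).
  apply: is_cvgB; last exact: is_cvg_cst.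
  by move/cvg_ex: A_sum => [l Al]; apply/cvg_ex; exists l; rewrite cvg_shiftS.
apply/funext => n; rewrite /series/= [in RHS]big_nat_recl//=.
by rewrite addrC addKr.
Qed.

Let A0sq : 0 < A 0%N ^+ 2. Proof. exact: exprn_gt0. Qed.

(** The rank does not depend on [s], because the missing variance only lowers the
    density. *)
Lemma density_le_eventually (eps : R) : 0 < eps ->
  exists s0 : R, exists2 N0 : nat, 0 < s0 & forall s N, s0 <= s -> (N0 <= N)%N ->
    (density Z (A 0%N) c N s <=
     (2 * std_pdf s * (halfmass_prod c s N * expR eps))%:E)%E.
Proof.
move=> eps0; pose eta := (expR eps - 1) / 2.
have eta0 : 0 < eta by rewrite divr_gt0// subr_gt0 expR_gt1.
have eta'0 : 0 < eta * A 0%N ^+ 2 by rewrite mulr_gt0.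
have [s0 s00 hs0] := error_sum_vanishes c_ge0 tail_sum eta'0.
have cvgV : (Num.sqrt (A 0%N ^+ 2 + sqsum c N))^-1 @[N --> \oo] --> (1 : R).
  have sq1 : Num.sqrt (A 0%N ^+ 2 + sqsum c N) @[N --> \oo] --> (1 : R).
    rewrite -(@sqrtr1 R); apply: continuous_cvg sqsum_cvg.
    exact: sqrt_continuous.
  by rewrite -(@invr1 R); apply: cvgV => //; exact: oner_neq0.
have [N0 _ hN0] : \forall N \near \oo,
    (Num.sqrt (A 0%N ^+ 2 + sqsum c N))^-1 < 1 + eta.
  by apply: (cvgr_lt _ cvgV); rewrite ltrDl.
exists s0; exists N0 => // s N hs hN; have s_ge0 : 0 <= s by exact: le_trans (ltW s00) hs.
apply: le_trans (density_upper hZ (A_gt0 0%N) c_ge0 s_ge0 (sqsum_le1 N)) _.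
rewrite lee_fin ler_wpM2l ?mulr_ge0 ?std_pdf_ge0//.
apply: ler_wpM2l; first by rewrite ltW// halfmass_prod_gt0.
have h1 := ltW (hN0 N hN).
have h2 : error_sum c s N / A 0%N ^+ 2 <= eta by rewrite ler_pdivrMr// hs0.
by apply: le_trans (lerD h1 h2) _; rewrite /eta; lra.
Qed.

(** Here the rank depends on [s], through the damping factor; Fatou's lemma will
    dispense with uniformity. *)
Lemma density_ge_eventually (eps : R) : 0 < eps ->
  exists2 s0 : R, 0 < s0 & forall s, s0 <= s -> \forall N \near \oo,
    ((2 * std_pdf s * (halfmass_prod c s N * expR (- eps)))%:E <=
     density Z (A 0%N) c N s)%E.
Proof.
move=> eps0; pose eta := (1 - expR (- eps)) / 3.
have eta0 : 0 < eta by rewrite divr_gt0// subr_gt0 expR_lt1 oppr_lt0.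
have eta'0 : 0 < eta * A 0%N ^+ 2 by rewrite mulr_gt0.
have [s1 s10 hs1] := error_sum_vanishes c_ge0 tail_sum eta'0.
have etaA : 0 < eta * A 0%N by rewrite mulr_gt0.
(* From [exp x >= x] and [s^2 >= s], the choice of [s2] makes the bump beyond [s] at
   most [eta * A 0]. *)
pose s2 := 2 / (A 0%N ^+ 2 * (eta * A 0%N)) + 1.
have s2_ge1 : 1 <= s2 by rewrite lerDr divr_ge0// mulr_ge0 ?ltW// mulr_gt0.
exists (s1 + s2) => [|s hs]; first by rewrite addr_gt0// (lt_le_trans ltr01).
have ss1 : s1 <= s by lra.
have ss2 : s2 <= s by lra.
have s_ge1 : 1 <= s by lra.
have s_ge0 : 0 <= s by lra.
have cut : expR (- (s ^+ 2 * A 0%N ^+ 2 / 2)) / A 0%N <= eta.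
  rewrite ler_pdivrMr// expRN invf_ple ?posrE ?expR_gt0//.
  apply: le_trans (expR_ge1Dx _).
  have h : 2 / (A 0%N ^+ 2 * (eta * A 0%N)) <= s ^+ 2.
    rewrite expr2; have : s <= s * s by rewrite ler_peMr.
    by move: ss2; rewrite /s2; lra.
  have -> : (eta * A 0%N)^-1 = A 0%N ^+ 2 / 2 * (2 / (A 0%N ^+ 2 * (eta * A 0%N))).
    by field; rewrite !gt_eqF.
  have half0 : 0 <= A 0%N ^+ 2 / 2 by rewrite divr_ge0// ltW.
  by have := ler_wpM2l half0 h; lra.
pose a2 := A 0%N ^+ 2.
have sgcvg : sqsum c N @[N --> \oo] --> 1 - a2.
  rewrite (_ : sqsum c = fun N => (a2 + sqsum c N) - a2); last first.
    by apply/funext => N; rewrite addrC addKr.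
  by apply: cvgB; [exact: sqsum_cvg|exact: cvg_cst].
have damp1 : damping (A 0%N) c N s @[N --> \oo] --> (1 : R).
  have e0 : - (s ^+ 2 * (1 - a2 - sqsum c N) / 2) @[N --> \oo] --> (0 : R).
    rewrite (_ : 0 = - (s ^+ 2 * (1 - a2 - (1 - a2)) / 2)); last by ring.
    apply: cvgN; apply: cvgMl; apply: cvgMr.
    by apply: cvgB => //; exact: cvg_cst.
  rewrite -expR0; apply: continuous_cvg e0; exact: continuous_expR.
have a2sg : a2 + sqsum c N @[N --> \oo] --> (1 : R) by exact: sqsum_cvg.
have lim1 : bump_limit c s N a2 (s * (1 - a2)) / A 0%N @[N --> \oo] --> (1 : R).
  have sqlim : Num.sqrt (a2 / (a2 + sqsum c N)) @[N --> \oo] --> A 0%N.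
    rewrite [X in _ --> X](_ : A 0%N = Num.sqrt (a2 / 1)); last first.
      by rewrite divr1 sqrtr_sqr gtr0_norm.
    have q : a2 / (a2 + sqsum c N) @[N --> \oo] --> a2 / 1.
      by apply: cvgMr; apply: cvgV a2sg; exact: oner_neq0.
    by apply: continuous_cvg q; exact: sqrt_continuous.
  have glim : gauss_bump (a2 + sqsum c N) (s * (1 - a2) - s * sqsum c N) 0
      @[N --> \oo] --> (1 : R).
    have wlim : s * (1 - a2) - s * sqsum c N @[N --> \oo] --> (0 : R).
      rewrite -(subrr (s * (1 - a2))); apply: cvgB; first exact: cvg_cst.
      exact: cvgMr.
    have e0 : - ((0 - (s * (1 - a2) - s * sqsum c N)) ^+ 2 /
        (2 * (a2 + sqsum c N))) @[N --> \oo] --> (0 : R).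
      rewrite [X in _ --> X](_ : 0 = - ((0 - 0) ^+ 2 / (2 * 1))); last first.
        by rewrite subrr expr0n/= mul0r oppr0.
      apply: cvgN; apply: cvgM; last first.
        by apply: cvgV; [rewrite mulr1|exact: cvgMr].
      have d0 : 0 - (s * (1 - a2) - s * sqsum c N) @[N --> \oo] --> (0 - 0 : R).
        by apply: cvgB => //; exact: cvg_cst.
      rewrite (_ : (fun x => _) = fun N => (0 - (s * (1 - a2) - s * sqsum c N)) *
          (0 - (s * (1 - a2) - s * sqsum c N))); last by apply/funext => N; rewrite expr2.
      by rewrite expr2; exact: cvgM.
    rewrite [X in _ --> X](_ : 1 = expR 0); last by rewrite expR0.
    by apply: continuous_cvg e0; exact: continuous_expR.
  rewrite [X in _ --> X](_ : 1 = A 0%N * 1 / A 0%N); last first.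
    by rewrite mulr1 divff ?gt_eqF.
  by apply: cvgMl; exact: cvgM.
have lim2 : damping (A 0%N) c N s *
    (bump_limit c s N a2 (s * (1 - a2)) / A 0%N - eta - eta)
    @[N --> \oo] --> (1 * (1 - eta - eta) : R).
  apply: cvgM => //; apply: cvgB; last exact: cvg_cst.
  by apply: cvgB => //; exact: cvg_cst.
have lt2 : expR (- eps) < 1 * (1 - eta - eta).
  have : expR (- eps) < 1 by rewrite expR_lt1 oppr_lt0.
  by rewrite /eta; lra.
have : \forall N \near \oo, expR (- eps) < damping (A 0%N) c N s *
    (bump_limit c s N a2 (s * (1 - a2)) / A 0%N - eta - eta).
  exact: (cvgr_gt _ lim2).
apply: filterS => N hN.
apply: le_trans (density_lower hZ (A_gt0 0%N) c_ge0 N s_ge0).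
rewrite lee_fin -[leRHS]mulrA; apply: ler_wpM2l; first by rewrite mulr_ge0 ?std_pdf_ge0.
rewrite [leRHS]mulrCA; apply: ler_wpM2l; first by rewrite ltW// halfmass_prod_gt0.
apply: le_trans (ltW hN) _; apply: ler_wpM2l; first exact: expR_ge0.
have h2 : error_sum c s N / A 0%N ^+ 2 <= eta by rewrite ler_pdivrMr// hs1.
by move: cut h2; rewrite -/a2; lra.
Qed.

End NormalizedTail.

(** * Comparison of the tails *)

Section Comparison.
Context d (T : measurableType d) (R : realType) (P : probability T R).
Variable Z : nat -> {RV P >-> R}.
Hypothesis hZ : iid_standard_normal Z.
Local Notation mu := (@lebesgue_measure R).

Lemma initial_sum_density (A : nat -> R) N (r : R) : 0 < A 0%N ->
  P [set t | r < initial_sum Z A N t] =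
  (\int[mu]_(s in `]r, +oo[) density Z (A 0%N) (fun i => A i.+1) N s)%E.
Proof. by move=> A0; exact: tail_density. Qed.

Variables A B : nat -> R.
Hypotheses (A_gt0 : forall n, 0 < A n) (B_gt0 : forall n, 0 < B n)
  (A_sum : cvgn (series A)) (B_sum : cvgn (series B))
  (A_sq : series (fun n => A n ^+ 2) @ \oo --> (1 : R))
  (B_sq : series (fun n => B n ^+ 2) @ \oo --> (1 : R))
  (B_noninc : nonincreasing_seq B)
  (AB_prod : prod_converges (fun n => 2 - A n / B n)).

Let densA := density Z (A 0%N) (fun i => A i.+1).
Let densB := density Z (B 0%N) (fun i => B i.+1).

(** At a common large [s] both densities are [2 * std_pdf s] times their product of half
    line masses, up to factors close to 1; the partial products increase with the
    rank, which lets a fixed rank for [A] meet arbitrarily large ranks for [B]. *)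
Lemma density_compare (eps : R) : 0 < eps ->
  exists s0 : R, exists N0 : nat, forall s N, s0 <= s -> (N0 <= N)%N ->
    (densA N s <= (expR eps)%:E * limn_einf (fun M => densB M s))%E.
Proof.
move=> eps0; have e3 : 0 < eps / 3 by rewrite divr_gt0.
have [s1 [N0 s10 h1]] := density_le_eventually hZ A_gt0 A_sum A_sq e3.
have [s2 s20 h2] := density_ge_eventually hZ B_gt0 B_sum B_sq e3.
have [s3 s30 h3] := halfmass_prod_compare e3 A_gt0 B_gt0 B_noninc AB_prod.
exists (s1 + s2 + s3); exists N0 => s N hs hN.
have ss1 : s1 <= s by lra.
have ss2 : s2 <= s by lra.
have ss3 : s3 <= s by lra.
have s_ge0 : 0 <= s by lra.
apply: le_trans (h1 s N ss1 hN) _.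
have := h2 s ss2 => hM.
have g0 := @std_pdf_ge0 R s.
set hA := halfmass_prod _ s N.
have -> : 2 * std_pdf s * (hA * expR (eps / 3)) =
    expR eps * (2 * std_pdf s * (expR (- (eps / 3)) * (hA * expR (- (eps / 3))))).
  have -> : expR (eps / 3) = expR eps * (expR (- (eps / 3)) * expR (- (eps / 3))).
    by rewrite -!expRD; congr expR; field.
  by ring.
rewrite EFinM; apply: lee_wpmul2l; first by rewrite lee_fin expR_ge0.
apply: limn_einf_ge.
near=> M.
have NM : (N <= M)%N by near: M; exact: nbhs_infty_ge.
apply: (@le_trans _ _ (2 * std_pdf s * (halfmass_prod (fun i => B i.+1) s M * expR (- (eps / 3))))%:E); last by near: M.
rewrite lee_fin ler_wpM2l ?mulr_ge0//.
rewrite mulrA ler_wpM2r ?expR_ge0//.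
have hAM : hA <= halfmass_prod (fun i => A i.+1) s M.
  by apply: halfmass_prod_mono => // i; exact: ltW.
have h := le_trans hAM (h3 s M ss3).
by rewrite expRN mulrC ler_pdivrMr ?expR_gt0// mulrC.
Unshelve. all: by end_near. Qed.

Lemma strict_tail_compare (eps : R) : 0 < eps -> exists r0 : R, forall r, r0 <= r ->
  (strict_tail Z A r <= (expR eps)%:E * strict_tail Z B r)%E.
Proof.
move=> eps0; have [s0 [N0 hs]] := density_compare eps0.
exists s0 => r hr; apply: strict_tail_le => //.
exists N0 => // N /= hN.
rewrite initial_sum_density//.
pose Rm := measurableTypeR R.
have mB M : measurable_fun (`]r, +oo[%classic : set Rm) (densB M).
  by apply: measurable_funTS; exact: measurable_density.
have dB0 M s : (0 <= densB M s)%E by apply: density_ge0.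
have mlim : measurable_fun (`]r, +oo[%classic : set Rm)
    (fun s => limn_einf (fun M => densB M s)).
  apply: (emeasurable_fun_cvg (fun n s => einfs (densB ^~ s) n)).
    exact: measurable_fun_einfs.
  by move=> s _; rewrite limn_einf_lim; exact: is_cvg_einfs.
have lim0 s : (0 <= limn_einf (fun M => densB M s))%E.
  by apply: limn_einf_ge; apply: nearW => M; exact: dB0.
apply: (@le_trans _ _ (\int[mu]_(s in `]r, +oo[)
    ((expR eps)%:E * limn_einf (fun M => densB M s)))%E).
  apply: ge0_le_integral => //=.
  - by move=> s _; apply: density_ge0.
  - by apply: measurable_funTS; exact: measurable_density.
  - exact: emeasurable_funM.
  - move=> s; rewrite in_itv/= andbT => rs; apply: hs => //.
    exact: le_trans hr (ltW rs).
have e0 : (0 <= (expR eps)%:E)%E by rewrite lee_fin expR_ge0.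
rewrite ge0_integralZl//; apply: lee_wpmul2l => //.
apply: le_trans (fatou _ _ mB _) _ => //.
apply: limn_einf_le => M; rewrite -initial_sum_density//.
exact: strict_tail_ge.
Qed.

(** The closed tail at [r] is the decreasing limit of the open tails at [r - 1 / k]. *)
Lemma tail_compare (eps : R) : 0 < eps -> exists r0 : R, forall r, r0 <= r ->
  (P [set t | (r%:E <= weighted_abs_sum Z A t)%E] <=
   (expR eps)%:E * P [set t | (r%:E <= weighted_abs_sum Z B t)%E])%E.
Proof.
move=> eps0; have [r0 h] := strict_tail_compare eps0.
exists (r0 + 1) => r hr.
have cB := cvgeZl (_ : (expR eps)%:E \is a fin_num) (@strict_tail_cvg _ _ _ P Z B B_gt0 r).
apply: cvge_ge (cB isT); apply: nearW => k /=.
apply: le_trans (h _ _).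
  apply: le_measure; rewrite ?inE.
  - exact: measurable_tail.
  - exact: measurable_strict_tail.
  move=> t /=; apply: lt_le_trans; rewrite lte_fin ltrBlDr ltrDl.
  by rewrite invr_gt0.
rewrite lerBrDr; apply: le_trans hr; rewrite lerD2l.
by rewrite invf_le1 ?ler1n.
Qed.

End Comparison.

Section Normalization.
Context d (T : measurableType d) (R : realType) (P : probability T R).
Variable Z : nat -> {RV P >-> R}.
Hypothesis hZ : iid_standard_normal Z.
Variable a : nat -> R.
Hypotheses (a_gt0 : forall n, 0 < a n) (a_noninc : nonincreasing_seq a)
  (a_sum : cvgn (series a)).
Let l := l2norm a.

Let sq_cvg : cvgn (series (fun n => a n ^+ 2)).
Proof.
apply: (@series_le_cvg _ _ (fun n => a 0%N * a n)).
- by move=> n; exact: sqr_ge0.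
- by move=> n; rewrite mulr_ge0// ltW.
- by move=> n; rewrite expr2 ler_pM2r// a_noninc.
- exact: is_cvg_seriesZ.
Qed.

Lemma l2norm_gt0 : 0 < l.
Proof.
rewrite sqrtr_gt0; apply: (@lt_le_trans _ _ (a 0%N ^+ 2)); first exact: exprn_gt0.
have -> : a 0%N ^+ 2 = series (fun n => a n ^+ 2) 1 by rewrite /series/= big_nat1.
apply: nondecreasing_cvgn_le => //.
by apply/nondecreasing_series => n _ _; exact: sqr_ge0.
Qed.

Lemma normalized_sq : series (fun n => (a n / l) ^+ 2) @ \oo --> (1 : R).
Proof.
have l0 := l2norm_gt0.
have l2 : l ^+ 2 = limn (series (fun n => a n ^+ 2)).
  rewrite sqr_sqrtr//; apply: limr_ge => //; apply: nearW => n.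
  by apply: sumr_ge0 => i _; exact: sqr_ge0.
have -> : series (fun n => (a n / l) ^+ 2) =
    fun n => series (fun n => a n ^+ 2) n / l ^+ 2.
  apply/funext => n; rewrite /series/= mulr_suml; apply: eq_bigr => i _.
  by rewrite exprMn exprVn.
rewrite -(@divff _ (l ^+ 2)); last by rewrite gt_eqF// exprn_gt0.
by apply: cvgMl; rewrite l2.
Qed.

Lemma normalized_sum : cvgn (series (fun n => a n / l)).
Proof.
rewrite (_ : series _ = fun n => series a n / l).
  by apply: is_cvgMl.
by apply/funext => n; rewrite /series/= mulr_suml.
Qed.

Lemma tail_normalized (r : R) :
  [set t | ((r * l)%:E <= weighted_abs_sum Z a t)%E] =
  [set t | (r%:E <= weighted_abs_sum Z (fun n => (a n / l)%R) t)%E].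
Proof.
have l0 := l2norm_gt0.
apply: eq_set => t.
have -> : weighted_abs_sum Z a t =
    (l%:E * weighted_abs_sum Z (fun n => (a n / l)%R) t)%E.
  rewrite /weighted_abs_sum -nneseriesZl; last first.
    by move=> n _; rewrite lee_fin mulr_ge0// divr_ge0// ltW.
  apply: eq_eseriesr => n _; rewrite -EFinM; congr (_%:E).
  by field; rewrite gt_eqF.
by rewrite mulrC EFinM lee_pmul2l.
Qed.

(** The tail event contains the event that [Z 0] lies in some far away interval. *)
Lemma tail_prob_gt0 (r : R) : 0 < tail_prob Z a r.
Proof.
rewrite /tail_prob fine_gt0//; apply/andP; split; last first.
  rewrite -ge0_fin_numE// fin_num_measure//; exact: measurable_tail.
pose y : R := `|r * l| / a 0%N.
pose I : set (measurableTypeR R) := `[y, y + 1]%classic.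
have y0 : 0 <= y by rewrite divr_ge0// ltW.
have mI : measurable I by exact: measurable_itv.
have PI : P (Z 0%N @^-1` I) = normal_prob 0 1 I by exact: hZ.2.
have sub : Z 0%N @^-1` I `<=` [set t | ((r * l)%:E <= weighted_abs_sum Z a t)%E].
  move=> t /=; rewrite /I/= in_itv/= => /andP[yZ _].
  apply: le_trans (initial_sum_le Z a_gt0 0 t).
  rewrite lee_fin /initial_sum /psum big_ord0 addr0.
  apply: le_trans (ler_norm _) _; rewrite (mulrC (a 0%N)) -ler_pdivrMr//.
  exact: le_trans yZ (ler_norm _).
apply: (@lt_le_trans _ _ (P (Z 0%N @^-1` I))); last first.
  apply: le_measure => //; rewrite inE; last exact: measurable_tail.
  exact: measurable_RV_preimage.
rewrite PI; apply: (@lt_le_trans _ _ (\int[lebesgue_measure]_(x in I) (std_pdf (y + 1))%:E)%E).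
  rewrite integral_cst//= /I lebesgue_measure_itv/= lte_fin ltrDl ltr01.
  by rewrite -EFinD (addrC y) addrK mule1 lte_fin std_pdf_gt0.
rewrite /normal_prob; apply: ge0_le_integral => //=.
- by move=> x _; rewrite lee_fin std_pdf_ge0.
- apply: measurable_funTS; apply/measurable_EFinP; exact: measurable_normal_pdf.
move=> x; rewrite /I/= in_itv/= => /andP[yx xy]; rewrite lee_fin.
apply: le_std_pdf; rewrite !ger0_norm//; first by rewrite addr_ge0.
exact: le_trans yx.
Qed.

End Normalization.

Theorem theorem2p1 (R : realType) (d : measure_display) (T : measurableType d)
    (P : probability T R) (Z : nat -> {RV P >-> R}) (a b : R^nat)
    (hZ : iid_standard_normal Z)
    (a_gt0 : forall n, 0 < a n) (b_gt0 : forall n, 0 < b n)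
    (a_noninc : nonincreasing_seq a) (b_noninc : nonincreasing_seq b)
    (a_sum : cvgn (series a)) (b_sum : cvgn (series b))
    (ab_prod : prod_converges
       (fun n => 2 - (a n / l2norm a) / (b n / l2norm b)))
    (ba_prod : prod_converges
       (fun n => 2 - (b n / l2norm b) / (a n / l2norm a))) :
  asymp_equiv (tail_prob Z a) (tail_prob Z b).
Proof.
(* The hypotheses are symmetric in the two sequences: one inequality suffices. *)
have half (a' b' : R^nat) : (forall n, 0 < a' n) -> (forall n, 0 < b' n) ->
    nonincreasing_seq a' -> nonincreasing_seq b' ->
    cvgn (series a') -> cvgn (series b') ->
    prod_converges (fun n => 2 - (a' n / l2norm a') / (b' n / l2norm b')) ->
    forall eps, 0 < eps -> exists r0 : R, forall r, r0 <= r ->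
      tail_prob Z a' r <= expR eps * tail_prob Z b' r.
  move=> a0 b0 na nb sa sb ab eps eps0.
  have la := l2norm_gt0 a0 na sa; have lb := l2norm_gt0 b0 nb sb.
  have nnb : nonincreasing_seq (fun n => b' n / l2norm b').
    by move=> m n mn; rewrite ler_pM2r ?invr_gt0// nb.
  have [r0 h] := tail_compare hZ (fun n => divr_gt0 (a0 n) la)
    (fun n => divr_gt0 (b0 n) lb) (normalized_sum sa) (normalized_sum sb)
    (normalized_sq a0 na sa) (normalized_sq b0 nb sb)
    nnb ab eps0.
  exists r0 => r hr; have := h r hr; rewrite -!tail_normalized//.
  have mA := measurable_tail Z a0 (r * l2norm a').
  have mB := measurable_tail Z b0 (r * l2norm b').
  by rewrite /tail_prob -lee_fin (EFinM (expR eps)) !fineK// fin_num_measure.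
have Hab := half _ _ a_gt0 b_gt0 a_noninc b_noninc a_sum b_sum ab_prod.
have Hba := half _ _ b_gt0 a_gt0 b_noninc a_noninc b_sum a_sum ba_prod.
apply/cvgrPdist_le => e e0.
(* With this choice the ratio lies between [1 / (1 + e)] and [1 + e]. *)
pose eps := ln (1 + e).
have eps0 : 0 < eps by rewrite ln_gt0// ltrDl.
have expeps : expR eps = 1 + e by rewrite lnK// posrE addr_gt0.
have [r1 h1] := Hab _ eps0; have [r2 h2] := Hba _ eps0.
exists (r1 + `|r2 - r1|); split; first exact: num_real.
move=> r hr.
have hr1 : r1 <= r by apply/ltW; apply: le_lt_trans hr; rewrite lerDl.
have hr2 : r2 <= r.
  by apply/ltW; apply: le_lt_trans hr; rewrite -lerBlDl ler_norm.
have Fb : 0 < tail_prob Z b r by exact: tail_prob_gt0.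
have u : tail_prob Z a r / tail_prob Z b r <= 1 + e.
  by rewrite ler_pdivrMr// -expeps h1.
have v : (1 + e)^-1 <= tail_prob Z a r / tail_prob Z b r.
  rewrite ler_pdivlMr// -ler_pdivlMl ?invr_gt0 ?addr_gt0// invrK -expeps.
  exact: h2.
have w : 1 - e <= (1 + e)^-1.
  by rewrite -[leRHS]mul1r ler_pdivlMr ?addr_gt0//; nra.
by rewrite ler_distlC; apply/andP; split; lra.
Qed.
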